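(* Let $G$ be a finite planar graph in which no triangle is adjacent to a triangle or to a $4$-cycle, and each $5$-cycle is adjacent to at most three triangles. Then $\mathrm{mad}(G)<4$. Hence $G$ is adaptably $3$-choosable and $(3,1)$-choosable.
   Context: A triangle is a $3$-cycle; two cycles are adjacent if they share a common edge. $\mathrm{mad}(G)=\max\{2|E(H)|/|V(H)| : H \text{ a subgraph of } G\}$. Given a (possibly improper) edge coloring $F$ of $G$ with integers, a vertex coloring $c$ is adapted to $F$ if no edge $uv$ satisfies $c(u)=c(v)=F(uv)$. $G$ is adaptably $k$-choosable if for every edge coloring $F$ and every list assignment $L$ with $|L(v)|\ge k$ for all $v$, there is a coloring $c$ adapted to $F$ with $c(v)\in L(v)$ for all $v$. A $(k,d)$-list assignment assigns to each vertex a list of at least $k$ colors such that adjacent vertices' lists share at most $d$ colors; $G$ is $(k,d)$-choosable if for every such assignment there is a proper vertex coloring from the lists. *)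

(* Defs.v *)
From HB Require Import structures.
From mathcomp Require Import all_boot all_order all_algebra.
From mathcomp Require all_classical all_reals all_analysis.
From mathcomp Require Rstruct Rstruct_topology.
From Stdlib Require Rdefinitions.
Notation R := Rdefinitions.R.

Set Implicit Arguments. Unset Strict Implicit. Unset Printing Implicit Defensive.
Import Order.TTheory GRing.Theory Num.Theory.

Definition simple_graph (T : finType) (e : rel T) : Prop :=
  symmetric e /\ irreflexive e.

Definition gedges (T : finType) (e : rel T) : {set {set T}} :=
  [set [set x; y] | x in T, y in T & e x y].

Definition is_subgraph (T : finType) (e : rel T)
  (H : {set T} * {set {set T}}) : bool :=
  (H.2 \subset gedges e) && [forall f in H.2, f \subset H.1].

(* mad(G) = max { 2|E(H)|/|V(H)| : H subgraph of G, V(H) nonempty }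
   (0 for the empty graph). *)
Definition mad (T : finType) (e : rel T) : rat :=
  \big[Order.max/0%R]_(H : {set T} * {set {set T}} |
        is_subgraph e H && (H.1 != set0))
     (((2 * #|H.2|)%N%:R : rat) / (#|H.1|%:R))%R.

(* A k-cycle (k >= 3) of G, identified with its edge set (as a subgraph). *)
Definition is_cycle (T : finType) (e : rel T) (k : nat) (C : {set {set T}})
  : Prop :=
  3 <= k /\ exists f : 'I_k -> T, injective f /\
    (forall i : 'I_k, e (f i) (f (ordS i))) /\
    C = [set [set f i; f (ordS i)] | i : 'I_k].

Definition adjacent_cycles (T : finType) (C D : {set {set T}}) : Prop :=
  C <> D /\ exists f, f \in C /\ f \in D.

Definition adapted (T : finType) (e : rel T) (F : {set T} -> int)
  (c : T -> int) : Prop :=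
  forall u v, e u v -> ~ (c u = F [set u; v] /\ c v = F [set u; v]).

Definition adaptably_choosable (T : finType) (e : rel T) (k : nat) : Prop :=
  forall (F : {set T} -> int) (L : T -> seq int),
    (forall v, k <= size (undup (L v))) ->
    exists c : T -> int, adapted e F c /\ forall v, c v \in L v.

Definition kd_list_assignment (T : finType) (e : rel T) (k d : nat)
  (L : T -> seq int) : Prop :=
  (forall v, k <= size (undup (L v))) /\
  (forall u v, e u v -> size (undup [seq x <- L u | x \in L v]) <= d).

Definition kd_choosable (T : finType) (e : rel T) (k d : nat) : Prop :=
  forall L : T -> seq int, kd_list_assignment e k d L ->
    exists c : T -> int, (forall v, c v \in L v) /\
      (forall u v, e u v -> c u <> c v).

(* Planarity: a topological embedding into the real plane R^2
   (Stdlib reals, viewed as a realType).  Vertices go to distinct points;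
   each edge xy is a simple arc (continuous, injective on [0,1]) from p x
   to p y (the arc for yx is the reverse one); arc interiors avoid all
   vertex points, and interiors of arcs of distinct edges are disjoint. *)
Module PlanarDef.
Import boolp classical_sets functions reals topology normedtype Rstruct Rstruct_topology.
Local Open Scope classical_set_scope.
Definition planar (T : finType) (e : rel T) : Prop :=
  exists (p : T -> (R * R)%type) (g : T -> T -> R -> (R * R)%type),
    injective p /\
    (forall x y, e x y ->
       [/\ {within [set t : R | (0 <= t <= 1)%R], continuous (g x y)},
           {in [set t : R | (0 <= t <= 1)%R] &, injective (g x y)},
           g x y 0%R = p x, g x y 1%R = p y &
           forall t : R, g y x t = g x y (1 - t)%R]) /\
    (forall x y z (t : R), e x y -> (0 < t < 1)%R -> g x y t <> p z) /\
    (forall x y u v (t s : R), e x y -> e u v ->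
       finset.setU (finset.set1 x) (finset.set1 y) != finset.setU (finset.set1 u) (finset.set1 v) ->
       (0 < t < 1)%R -> (0 < s < 1)%R -> g x y t <> g u v s).
End PlanarDef.
Notation planar := PlanarDef.planar.

(* Main.v *)
Require Import Defs.
From mathcomp Require Import all_boot all_order all_algebra.
From mathcomp Require Import zify ring lra.
From mathcomp Require boolp classical_sets functions reals topology normedtype.
From mathcomp Require derive Rstruct Rstruct_topology.
Set Implicit Arguments. Unset Strict Implicit. Unset Printing Implicit Defensive.
Import Order.TTheory GRing.Theory Num.Theory.

(** Let [A] be the edge set of a nonempty subgraph on [U].  Cutting every arc of
    a drawing into thirds gives finitely many compact pieces which are apart
    unless they must touch; on a fine enough square grid they become disjoint
    connected branch sets, so the graph is a minor of a grid.  No form of the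
    Jordan curve theorem is needed any more: an even set of grid edges bounds the
    set of cells having an odd number of its vertical edges on their left.  The
    boundaries of the faces of the minor are therefore even edge sets which cover
    each edge at most twice and span the cycle space, and since the latter has
    dimension at least [|A| - |U| + 1], the family [F] of distinct nonempty face
    boundaries satisfies [|A| + 1 <= |F| + |U|].

    An even set of at most five edges is a cycle.  Give 6 units of charge to each
    edge; it hands 4 units to a triangular face and 2 to the other side, or 3 to
    each side if it lies on no triangular face.  By the hypotheses on short cycles
    every face receives at least 12, so [2 |F| <= |A|] and [|A| + 2 <= 2 |U|],
    that is mad < 4.

    By Hakimi's theorem the edges can then be oriented with all outdegrees at most
    2.  A vertex with three colours can avoid the colours of its outgoing edges,
    which makes the colouring adapted. *)

(** * Even edge sets of a grid *)

Definition grid_adj (N : nat) : rel ('I_N * 'I_N) := fun a b =>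
  ((a.1 == b.1 :> nat) && ((a.2.+1 == b.2 :> nat) || (b.2.+1 == a.2 :> nat))) ||
  ((a.2 == b.2 :> nat) && ((a.1.+1 == b.1 :> nat) || (b.1.+1 == a.1 :> nat))).

Definition inside (P : finType) (r : rel P) (B : {set P}) : rel P :=
  [rel a b | [&& r a b, a \in B & b \in B]].

(** Branch sets are kept off the border so that each of their points has four neighbours and lies
    among four cells, as the parity counts require. *)
Record grid_minor (T : finType) (e : rel T) (N : nat) (B : T -> {set 'I_N * 'I_N}) :
  Prop :=
  GridMinor {
  gm_disj : forall x y, x != y -> [disjoint B x & B y];
  gm_conn : forall x a b, a \in B x -> b \in B x ->
    connect (inside (@grid_adj N) (B x)) a b;
  gm_adj : forall x y, e x y ->
    exists2 ab, (ab.1 \in B x) && (ab.2 \in B y) & grid_adj ab.1 ab.2;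
  gm_inner : forall x a, a \in B x -> [&& 0 < a.1, a.1.+1 < N, 0 < a.2 & a.2.+1 < N] }.

Lemma grid_adj_sym N : symmetric (@grid_adj N).
Proof. by move=> a b; rewrite /grid_adj ![_ == (b.1 : nat)]eq_sym
  ![_ == (b.2 : nat)]eq_sym; lia. Qed.

Lemma inside_sym (P : finType) (r : rel P) B : symmetric r -> symmetric (inside r B).
Proof. by move=> rs a b; rewrite /inside /= rs [(a \in B) && _]andbC. Qed.

Lemma inside_connect_sym (P : finType) (r : rel P) B : symmetric r ->
  connect_sym (inside r B).
Proof. by move=> rs; apply: sym_connect_sym; apply: inside_sym. Qed.

(** All vertices of a path from [a] inside [Z] belong to the component of [a]. Branch sets will be
    such components. *)
Lemma component_connected (P : finType) (r : rel P) (Z : {set P}) (a c : P) :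
  connect (inside r Z) a c ->
  connect (inside r [set d in Z | connect (inside r Z) a d]) a c.
Proof.
set K := [set d in Z | _].
suff H p b : path (inside r Z) b p -> connect (inside r Z) a b ->
  connect (inside r K) b (last b p).
  by case/connectP => p pp ->; apply: H.
elim: p b => [|d p IH] b /=; first by rewrite connect0.
move=> /andP[bd pp] ab.
have ad : connect (inside r Z) a d by apply: connect_trans ab (connect1 bd).
apply: connect_trans (IH d pp ad); apply: connect1.
by case/and3P: bd => /= rbd bZ dZ; rewrite /inside /= rbd !inE bZ dZ ab ad.
Qed.

Lemma addb_sum_support (P : finType) (F : P -> bool) (r : seq P) :
  uniq r -> (forall b, F b -> b \in r) ->
  \big[addb/false]_b F b = \big[addb/false]_(b <- r) F b.
Proof.
move=> ur H; rewrite (big_uniq _ ur) /= [RHS]big_mkcond /=.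
by apply: eq_bigr => b _; case: ifP => // /negbT nb; apply/negbTE; apply: contra nb;
  apply: H.
Qed.

Section GridCycles.
Variable N : nat.
Notation Pt := ('I_N.+1 * 'I_N.+1)%type.
Implicit Types (a b : Pt) (f : nat * nat -> bool).

Definition inner a : bool := [&& 0 < a.1, a.1.+1 < N.+1, 0 < a.2 & a.2.+1 < N.+1].

(* Cell [(i, j)] is the unit square with lower left corner [(i, j)]; the two
   cells along a grid edge are found from the lower left end of the edge. *)
Definition sides a b : (nat * nat) * (nat * nat) :=
  if a.1 == b.1 :> nat then ((a.1 : nat, minn a.2 b.2), (a.1.-1, minn a.2 b.2))
  else ((minn a.1 b.1, a.2 : nat), (minn a.1 b.1, a.2.-1)).

(** The boundary modulo 2 of the set of cells with indicator [f]. *)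
Definition cell_bd f a b : bool :=
  grid_adj a b && (f (sides a b).1 (+) f (sides a b).2).

Definition gp (i j : nat) : Pt := (inord i, inord j).

Lemma gpE a : a = gp a.1 a.2.
Proof. by case: a => a1 a2; rewrite /gp /= !inord_val. Qed.

Lemma sides_sym a b : grid_adj a b -> sides a b = sides b a.
Proof.
rewrite /grid_adj /sides eq_sym minnC (minnC a.1).
case: eqP => [->//|ne]; rewrite /= => /andP[/eqP-> _] //.
Qed.

Lemma cell_bd_sym f : symmetric (cell_bd f).
Proof.
move=> a b; rewrite /cell_bd grid_adj_sym; case: (boolP (grid_adj b a)) => //= ba.
by rewrite (sides_sym ba).
Qed.

Lemma grid_sum a (F : Pt -> bool) : inner a -> (forall b, F b -> grid_adj a b) ->
  \big[addb/false]_b F b = F (gp a.1.-1 a.2) (+) (F (gp a.1.+1 a.2) (+)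
     (F (gp a.1 a.2.-1) (+) F (gp a.1 a.2.+1))).
Proof.
case: a => a1 a2 /and4P[/= h1 h2 h3 h4] H.
pose r := [:: gp a1.-1 a2; gp a1.+1 a2; gp a1 a2.-1; gp a1 a2.+1].
rewrite (@addb_sum_support _ _ r).
- by rewrite /r !big_cons big_nil addbF.
- rewrite /r /= !inE -!pair_eqE /= -!val_eqE /= !inordK ?ltnS; lia.
- move=> [b1 b2] /H; rewrite /gp /grid_adj /r !inE -!pair_eqE /= -!val_eqE /= !inordK
    ?ltnS; lia.
Qed.

Lemma gp1 i j : i <= N -> (gp i j).1 = i :> nat.
Proof. by move=> h; rewrite /= inordK. Qed.

(** Each of the four cells around [a] lies along exactly two of the four edges at [a], so its
    contributions cancel. *)
Lemma cell_bd_even f a : inner a -> \big[addb/false]_b cell_bd f a b = false.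
Proof.
case: a => a1 a2 ia; rewrite (grid_sum ia); last by move=> b /andP[].
case/and4P: ia => /= h1 h2 h3 h4.
rewrite /cell_bd /grid_adj /sides /= !inordK; try lia.
have -> : (a1.-1.+1 == a1 :> nat) by lia.
have -> : (a2.-1.+1 == a2 :> nat) by lia.
rewrite !eqxx !orbT /=.
have -> : (a1 == a1.-1 :> nat) = false by lia.
have -> : (a1 == a1.+1 :> nat) = false by lia.
have -> : minn a1 a1.-1 = a1.-1 by lia.
have -> : minn a1 a1.+1 = a1 by lia.
have -> : minn a2 a2.-1 = a2.-1 by lia.
have -> : minn a2 a2.+1 = a2 by lia.
rewrite /= ?orbT ?eqxx /=.
by case: (f _); case: (f _); case: (f _); case: (f _).
Qed.

(** Ray shooting: a cell is selected by the parity of the vertical edges of [s] to its left. Moving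
    to the next column adds one edge to the count; moving to the next row is controlled by evenness
    at the vertices between the two rows. *)
Lemma even_cell_bd (s : rel Pt) : symmetric s -> (forall a b, s a b -> grid_adj a b) ->
  (forall a b, s a b -> inner a) -> (forall a, \big[addb/false]_b s a b = false) ->
  exists f, forall a b, inner a -> s a b = cell_bd f a b.
Proof.
move=> ssym sadj sin seven.
pose v i j := s (gp i j) (gp i j.+1).
pose h i j := s (gp i j) (gp i.+1 j).
pose f (c : nat * nat) := \big[addb/false]_(k < c.1.+1) v k c.2.
have v0 j : v 0 j = false.
  by apply/negP => /sin /and4P[]; rewrite gp1.
have h0 j : h 0 j = false.
  by apply/negP => /sin /and4P[]; rewrite gp1.
have ev i j : i.+1 < N -> j.+1 < N ->
  h i j.+1 (+) h i.+1 j.+1 (+) v i.+1 j (+) v i.+1 j.+1 = false.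
  move=> iN jN; have := seven (gp i.+1 j.+1).
  rewrite (@grid_sum (gp i.+1 j.+1)); last by move=> b; apply: sadj.
    rewrite /= !inordK; try lia.
    by rewrite ssym [s _ (gp _ j)]ssym -/(h i j.+1) -/(h i.+1 j.+1) -/(v i.+1 j)
      -/(v i.+1 j.+1) !addbA.
  by rewrite /inner /= !inordK; lia.
(* Induction from the left border, where there are no edges; evenness at [(m.+1, j.+1)] carries the
   identity one column further. *)
have fh m j : m < N -> j.+1 < N -> f (m, j.+1) (+) f (m, j) = h m j.+1.
  elim: m => [|m IH] mN jN.
    by rewrite /f /= !big_ord_recl !big_ord0 /= !v0 h0.
  move: (IH (ltnW mN) jN) (ev m j mN jN); rewrite /f /= => IH' e1.
  rewrite ![\big[_/_]_(k < m.+2) _]big_ord_recr /=.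
  move: IH' e1; case: (\big[_/_]_(_ < _) _); case: (\big[_/_]_(_ < _) _);
  by case: (h m _); case: (h m.+1 _); case: (v m.+1 j); case: (v m.+1 _).
have fv i j : f (i.+1, j) (+) f (i, j) = v i.+1 j.
  rewrite /f /= big_ord_recr /= addbC.
  by case: (\big[_/_]_(_ < _) _); case: (v _ _).
exists f.
(* One inner end is enough here, so the ends may be swapped to put the lower left one first. *)
suff W a b : inner a || inner b -> a.1 <= b.1 -> a.2 <= b.2 -> s a b = cell_bd f a b.
  move=> a b ia; have [ab|nab] := boolP (grid_adj a b); last first.
    by rewrite /cell_bd (negbTE nab); apply/negbTE; apply: contra nab => /sadj.
  have : (a.1 <= b.1) && (a.2 <= b.2) || (b.1 <= a.1) && (b.2 <= a.2).
    by move: ab; rewrite /grid_adj; lia.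
  case/orP => /andP[h1 h2]; first by apply: W; rewrite ?ia.
  by rewrite ssym cell_bd_sym; apply: W; rewrite ?ia ?orbT.
move=> iab h1 h2.
have [ab|nab] := boolP (grid_adj a b); last first.
  by rewrite /cell_bd (negbTE nab); apply/negbTE; apply: contra nab => /sadj.
rewrite /cell_bd ab /= /sides; case: eqP => [e1|ne1].
  have e2 : b.2 = a.2.+1 :> nat by move: ab; rewrite /grid_adj; lia.
  have -> : minn a.2 b.2 = a.2 by lia.
  have -> : s a b = v a.1 a.2 by rewrite /v {1}(gpE a) {1}(gpE b) -e1 e2.
  have -> : a.1 = a.1.-1.+1 :> nat by case/orP: iab => /and4P[]; lia.
  by rewrite /= fv.
have e1 : b.1 = a.1.+1 :> nat by move: ab; rewrite /grid_adj; lia.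
have e2 : b.2 = a.2 :> nat by move: ab; rewrite /grid_adj; lia.
have -> : minn a.1 b.1 = a.1 by lia.
have -> : s a b = h a.1 a.2 by rewrite /h {1}(gpE a) {1}(gpE b) e1 e2.
have e3 : a.2 = a.2.-1.+1 :> nat by case/orP: iab => /and4P[]; lia.
have [m1 m2] : a.1 < N /\ a.2 < N by case/orP: iab => /and4P[]; lia.
by rewrite [in RHS]e3 /= fh -?e3.
Qed.
End GridCycles.

Lemma odd_cardE (P : finType) (A : {pred P}) : odd #|A| = \big[addb/false]_x (x \in A).
Proof.
rewrite -sum1_card (big_morph odd oddD (erefl _)) big_mkcond /=.
by apply: eq_bigr => x _; case: ifP.
Qed.

Lemma addb_sum_pred1 (P : finType) (x : P) (F : P -> bool) :
  \big[addb/false]_y ((y == x) && F y) = F x.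
Proof.
rewrite (bigD1 x) //= eqxx big1 ?addbF // => y /negbTE ->.
by [].
Qed.

(** Handshake lemma modulo 2: ordering pairs by [enum_rank] splits [s] into two mutually transposed
    halves whose sums cancel. *)
Lemma addb_sum_square (P : finType) (s : rel P) (B : {set P}) : symmetric s ->
  irreflexive s ->
  \big[addb/false]_(c in B) \big[addb/false]_(d in B) s c d = false.
Proof.
move=> ss si; pose t c d := s c d && (enum_rank c < enum_rank d).
have st c d : s c d = t c d (+) t d c.
  rewrite /t (ss d); case: (ltngtP (enum_rank c) (enum_rank d)) => [_|_|];
    rewrite ?andbF ?addbF ?andbT //.
  by move/val_inj/enum_rank_inj => ->; rewrite si.
under eq_bigr => c _ do (under eq_bigr => d _ do rewrite st); rewrite [X in X = _]/=.
under eq_bigr => c _ do rewrite big_split /=.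
by rewrite big_split /= [X in _ (+) X]exchange_big /= addbb.
Qed.

(** * Edge sets with prescribed odd vertices *)

Section Join.
Variables (P : finType) (g : rel P) (B : {set P}).
Hypothesis gsym : symmetric g.

(** Add up the edges of a walk modulo 2: every intermediate visit contributes two edge ends, so only
    [a] and [b] remain. *)
Lemma path_chain a b : connect (inside g B) a b ->
  exists s : rel P, [/\ symmetric s, (forall c d, s c d -> inside g B c d) &
    forall c, \big[addb/false]_d s c d = (c == a) (+) (c == b)].
Proof.
case/connectP => p; elim: p a => [|x p IH] a /=.
  move=> _ ->; exists (fun _ _ => false); split => // c.
  by rewrite big1 // addbb.
move=> /andP[ax pp] lb; have [s [ss si se]] := IH x pp lb.
exists (fun c d => s c d (+) (((c == a) && (d == x)) (+) ((c == x) && (d == a)))); split.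
- move=> c d /=; rewrite ss; congr (_ (+) _); rewrite addbC.
  by rewrite [(c == x) && _]andbC [(c == a) && _]andbC.
- move=> c d; case scd: (s c d); first by move=> _; apply: si.
  rewrite addFb; case: andP => [[/eqP-> /eqP->]|_] //.
  by case: andP => [[/eqP-> /eqP->]|_] //; rewrite inside_sym.
move=> c; rewrite !big_split /= se.
rewrite (eq_bigr (fun d => (d == x) && (c == a))); last by move=> d _; rewrite andbC.
rewrite [X in _ (+) (_ (+) X)](eq_bigr (fun d => (d == a) && (c == x)));
  last by move=> d _; rewrite andbC.
rewrite (addb_sum_pred1 x (fun=> c == a)) (addb_sum_pred1 a (fun=> c == x)).
by case: (c == x); case: (c == b); case: (c == a).
Qed.

(** Existence of T-joins: connect each demanded vertex to a fixed one [r] by a walk and add up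
    modulo 2. The surplus at [r] vanishes because the demand has even size. *)
Lemma join_chain (dem : P -> bool) :
  (forall a b, a \in B -> b \in B -> connect (inside g B) a b) ->
  (forall c, dem c -> c \in B) -> \big[addb/false]_c dem c = false ->
  exists s : rel P, [/\ symmetric s, (forall c d, s c d -> inside g B c d) &
    forall c, \big[addb/false]_d s c d = dem c].
Proof.
move=> conn demB dem0.
case: (pickP dem) => [r dr|no]; last first.
  exists (fun _ _ => false); split => // c.
  by rewrite big1 // no.
have rB := demB r dr.
suff [s [ss si se]] : exists s :
  rel P, [/\ symmetric s, (forall c d, s c d -> inside g B c d) &
    forall c, \big[addb/false]_d s c d = \big[addb/false]_(p <- enum dem)
      ((c == p) (+) (c == r))].
  exists s; split => // c; rewrite se big_enum /= big_split /=.
  rewrite big_mkcond /= (eq_bigr (fun p => (p == c) && dem p)); last first.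
    by move=> p _; rewrite eq_sym unfold_in; case: (dem p); case: (p == c).
  rewrite addb_sum_pred1 [X in _ (+) X]big_mkcond /=.
  case: (c == r); last by rewrite big1 ?addbF // => p _; case: ifP.
  rewrite (eq_bigr dem) ?dem0 ?addbF // => p _.
  by rewrite unfold_in; case: (dem p).
have : all [in B] (enum dem) by apply/allP => p; rewrite mem_enum => /demB.
elim: (enum dem) => [_|p l IH /= /andP[pB lB]].
  by exists (fun _ _ => false); split => // c; rewrite big_nil big1.
have [s [ss si se]] := IH lB.
have [t [ts ti te]] := path_chain (conn p r pB rB).
exists (fun c d => t c d (+) s c d); split.
- by move=> c d /=; rewrite ss ts.
- move=> c d; case tcd: (t c d); [by move=> _; apply: ti | by apply: si].
by move=> c; rewrite big_split /= se te big_cons.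
Qed.
End Join.

(** * Faces of a grid minor *)

(** For a set of edges, membership in the cycle space over the field with two elements. *)
Definition even_set (T : finType) (C : {set {set T}}) : bool :=
  [forall u, ~~ odd #|[set f in C | u \in f]|].

Lemma set2_inj (T : finType) (x y x' y' : T) : [set x; y] = [set x'; y'] ->
  (x = x' /\ y = y') \/ (x = y' /\ y = x').
Proof.
move=> E.
have hx : x \in [set x'; y'] by rewrite -E !inE eqxx.
have hy : y \in [set x'; y'] by rewrite -E !inE eqxx orbT.
have hx' : x' \in [set x; y] by rewrite E !inE eqxx.
have hy' : y' \in [set x; y] by rewrite E !inE eqxx orbT.
move: hx hy hx' hy'; rewrite !inE.
by do 4![case/orP => /eqP ?]; subst; auto.
Qed.

Lemma gedgesP (T : finType) (e : rel T) x y : symmetric e ->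
  ([set x; y] \in gedges e) = e x y.
Proof.
move=> es; apply/imset2P/idP => [[x' y' _]|exy]; last by exists x y; rewrite ?inE.
by rewrite inE => exy' /set2_inj [[-> ->]|[-> ->]] //; rewrite es.
Qed.

Lemma gedges_ex (T : finType) (e : rel T) f : f \in gedges e ->
  exists x y, e x y /\ f = [set x; y].
Proof. by case/imset2P => x y _; rewrite inE => exy ->; exists x, y. Qed.

Lemma odd_degE (T : finType) (e : rel T) (C : {set {set T}}) u :
  simple_graph e -> C \subset gedges e ->
  odd #|[set f in C | u \in f]| = \big[addb/false]_v ([set u; v] \in C).
Proof.
move=> [es ei] CA; rewrite -odd_cardE.
rewrite -(card_imset (mem [pred v | [set u; v] \in C]) (f := fun v => [set u; v]));
  last first.
  by move=> v w /set2_inj [[]|[-> ->]].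
congr (odd #|pred_of_set _|); apply/setP => f; rewrite !inE; apply/andP/imsetP.
  case=> fC uf; have [x [y [exy fE]]] := gedges_ex (subsetP CA f fC).
  move: uf; rewrite fE !inE => /orP[/eqP ux|/eqP uy].
    by exists y; rewrite ?inE ux // -fE.
  by exists x; rewrite ?inE uy setUC // -fE.
by case=> v; rewrite inE => vC ->; rewrite !inE eqxx.
Qed.

Section MacLane.
Variables (T : finType) (e : rel T) (N : nat) (B : T -> {set 'I_N.+1 * 'I_N.+1}).
Hypothesis (esg : simple_graph e) (gm : grid_minor e B).
Notation Pt := ('I_N.+1 * 'I_N.+1)%type.
Local Notation adj := (@grid_adj N.+1).

Let esym : symmetric e. Proof. by case: esg. Qed.
Let eirr : irreflexive e. Proof. by case: esg. Qed.

Lemma edge_neq x y : e x y -> x != y.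
Proof. by apply: contraTneq => ->; rewrite eirr. Qed.

Lemma blob_uniq x y c : c \in B x -> c \in B y -> x = y.
Proof.
move=> cx cy; apply/eqP; apply/negPn/negP => xy.
by have /pred0P/(_ c) := gm_disj gm xy; rewrite /= cx cy.
Qed.

(** The grid edge representing [xy] is chosen for the pair ordered by [enum_rank], so that [a x y]
    and [a y x] are the two ends of one and the same grid edge. *)
Lemma links_exist : exists a : T -> T -> Pt, forall x y, e x y ->
  (a x y \in B x) /\ adj (a x y) (a y x).
Proof.
pose ok x y (ab : Pt * Pt) := [&& ab.1 \in B x, ab.2 \in B y & adj ab.1 ab.2].
pose pk x y : Pt * Pt := odflt (gp N 0 0, gp N 0 0) [pick ab | ok x y ab].
have pkP x y : e x y -> ok x y (pk x y).
  move=> exy; rewrite /pk; case: pickP => [ab //|no].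
  by have [ab /andP[h1 h2] h3] := gm_adj gm exy; have := no ab; rewrite /ok h1 h2 h3.
exists (fun x y => if enum_rank x < enum_rank y then (pk x y).1 else (pk y x).2) => x y
  exy.
have := pkP x y exy; have := pkP y x;
  rewrite esym => /(_ exy) /and3P[h1 h2 h3] /and3P[k1 k2 k3].
case: (ltngtP (enum_rank x) (enum_rank y)) => [_|_|]; first by split.
  by split => //; rewrite grid_adj_sym.
by move/val_inj/enum_rank_inj => xy; move: (edge_neq exy); rewrite xy eqxx.
Qed.

Variable a : T -> T -> Pt.
Hypothesis aP : forall x y, e x y -> (a x y \in B x) /\ adj (a x y) (a y x).
Lemma link_in x y : e x y -> a x y \in B x.
Proof. by move=> /aP[]. Qed.

Variable A : {set {set T}}.
Hypothesis Asub : A \subset gedges e.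

Definition linked x y := [set x; y] \in A.

Lemma linked_edge x y : linked x y -> e x y.
Proof. by move=> /(subsetP Asub); rewrite gedgesP. Qed.

(** The part of the grid that realises the minor with edge set [A]: everything inside branch sets,
    and a single link per edge of [A]. *)
Definition kept : rel Pt := fun c d =>
  adj c d && ([exists x, (c \in B x) && (d \in B x)] ||
              [exists x, exists y, [&& linked x y, c == a x y & d == a y x]]).

Lemma kept_inner c d : kept c d -> inner c.
Proof.
case/andP => _ /orP[/existsP[x /andP[h1 _]]|/existsP[x /existsP[y /and3P[h1 /eqP-> h3]]]].
  exact: (gm_inner gm h1).
by have [h _] := aP (linked_edge h1); apply: (gm_inner gm h).
Qed.

Lemma kept_leave u c d : c \in B u -> d \notin B u -> kept c d ->
  exists v, [/\ linked u v, c = a u v & d = a v u].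
Proof.
move=> cu du /andP[_ /orP[/existsP[x /andP[h1 h2]]|]].
  by move: du; rewrite (blob_uniq cu h1) h2.
case/existsP => x /existsP[y /and3P[h1 /eqP h2 /eqP h3]].
have [ax _] := aP (linked_edge h1).
have xu : x = u by apply: (@blob_uniq _ _ c) => //; rewrite h2.
by subst x; exists y.
Qed.

Lemma leave_uniq u v w : linked u v -> linked u w -> a v u = a w u -> v = w.
Proof.
move=> uv uw E.
have h1 : a v u \in B v by apply: link_in; rewrite esym; apply: linked_edge.
have h2 : a w u \in B w by apply: link_in; rewrite esym; apply: linked_edge.
by apply: blob_uniq h1 _; rewrite E.
Qed.

(** Contracting branch sets preserves evenness. In the sum of the degrees over [B u], edges inside
    [B u] count twice, and the edges leaving it are links at [u]. *)
Lemma kept_project (s : rel Pt) u : symmetric s -> irreflexive s ->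
  (forall c d, c \in B u -> s c d -> kept c d) ->
  (forall c, c \in B u -> \big[addb/false]_d s c d = false) ->
  \big[addb/false]_v (linked u v && s (a u v) (a v u)) = false.
Proof.
move=> ss si sk se.
have : \big[addb/false]_(c in B u) \big[addb/false]_d s c d = false by rewrite big1.
under eq_bigr => c _ do rewrite (bigID (mem (B u))) /=.
rewrite big_split /= addb_sum_square // addFb => E0; rewrite -[RHS]E0.
rewrite [RHS]big_mkcond /=.
transitivity (\big[addb/false]_v \big[addb/false]_c \big[addb/false]_d
   ((d == a v u) && ((c == a u v) && (linked u v && s c d)))).
  apply: eq_bigr => v _.
  transitivity (\big[addb/false]_c ((c == a u v) && (linked u v && s c (a v u)))).
    by rewrite addb_sum_pred1.
  by apply: eq_bigr => c _; rewrite addb_sum_pred1.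
rewrite exchange_big /=; apply: eq_bigr => c _.
rewrite exchange_big /=.
have [cu|cu] := boolP (c \in B u); last first.
  rewrite big1 // => d _; rewrite big1 // => v _; apply/negP => /and4P[_ /eqP cE uv _].
  by move: cu; rewrite cE; have [-> _] := aP (linked_edge uv).
rewrite [RHS]big_mkcond /=; apply: eq_bigr => d _.
have [du|du] := boolP (d \in B u) => /=.
  rewrite big1 // => v _; apply/negP => /and4P[/eqP dE _ uv _].
  have evu : e v u by rewrite esym; apply: linked_edge.
  have [dv _] := aP evu; rewrite dE in du.
  by move: (edge_neq evu); rewrite (blob_uniq dv du) eqxx.
have [scd|scd] := boolP (s c d); last by rewrite big1 // => v _; rewrite !andbF.
have [v [uv cE dE]] := kept_leave cu du (sk c d cu scd).
rewrite (bigD1 v) //= dE cE !eqxx uv /= big1 // => w wv;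
  apply/negP => /and4P[/eqP E _ uw _].
by move: wv; rewrite (leave_uniq uv uw E) eqxx.
Qed.

Lemma even_relE (C : {set {set T}}) : C \subset gedges e ->
  even_set C = [forall u, ~~ \big[addb/false]_v ([set u; v] \in C)].
Proof. by move=> Cs; apply: eq_forallb => u; rewrite (odd_degE _ esg Cs). Qed.

(* Inside each connected branch set, the link ends of odd demand are joined up
   by paths. *)
Lemma kept_lift (Z : {set {set T}}) : Z \subset A -> even_set Z ->
  exists s : rel Pt, [/\ symmetric s, (forall c d, s c d -> kept c d),
    (forall c, \big[addb/false]_d s c d = false) &
    forall x y, linked x y -> s (a x y) (a y x) = ([set x; y] \in Z)].
Proof.
move=> ZA; rewrite even_relE ?(subset_trans ZA) // => /forallP Zev.
pose z x y := [set x; y] \in Z.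
have zl x y : z x y -> linked x y by apply: (subsetP ZA).
have zsym : symmetric z by move=> x y; rewrite /z setUC.
(* The links of [Z] alone; they may have odd degree at single grid points although [Z] is even. *)
pose s0 c d := [exists x, exists y, [&& z x y, c == a x y & d == a y x]].
have s0sym : symmetric s0.
  suff H c d : s0 c d -> s0 d c by move=> c d; apply/idP/idP; apply: H.
  case/existsP => x /existsP[y /and3P[h1 h2 h3]]; apply/existsP; exists y;
    apply/existsP; exists x.
  by rewrite zsym h1 h2 h3.
have s0k c d : s0 c d -> kept c d.
  case/existsP => x /existsP[y /and3P[/zl h1 /eqP h2 /eqP h3]]; rewrite /kept h2 h3.
  have [_ ->] := aP (linked_edge h1); apply/orP; right; apply/existsP; exists x;
    apply/existsP; exists y.
  by rewrite h1 !eqxx.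
have s0deg u c : c \in B u ->
  \big[addb/false]_d s0 c d = \big[addb/false]_v ((c == a u v) && z u v).
  move=> cu.
  transitivity (\big[addb/false]_v \big[addb/false]_d
    ((d == a v u) && ((c == a u v) && z u v))); last first.
    by apply: eq_bigr => v _; rewrite addb_sum_pred1.
  rewrite exchange_big /=; apply: eq_bigr => d _.
  have [|no] := boolP (s0 c d).
    case/existsP => x /existsP[y /and3P[zxy /eqP cE /eqP dE]].
    have [ax _] := aP (linked_edge (zl _ _ zxy)).
    have xu : x = u by apply: (@blob_uniq _ _ c) => //; rewrite cE.
    subst x; rewrite (bigD1 y) //= cE dE !eqxx zxy big1 // => w wv;
      apply/negP => /and3P[/eqP E _ /zl uw].
    by move: wv; rewrite (leave_uniq (zl _ _ zxy) uw E) eqxx.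
  rewrite big1 // => v _; apply/negP => /and3P[/eqP dE /eqP cE zuv].
  by case/negP: no; apply/existsP; exists u; apply/existsP; exists v;
    rewrite zuv dE cE !eqxx.
pose dem u c := (c \in B u) && \big[addb/false]_d s0 c d.
have join u : exists s : rel Pt,
  [/\ symmetric s, (forall c d, s c d -> inside adj (B u) c d) &
    forall c, \big[addb/false]_d s c d = dem u c].
  apply: join_chain.
  - exact: grid_adj_sym.
  - by move=> c d; apply: (gm_conn gm).
  - by move=> c /andP[].
  (* The demand in [B u] adds up to the degree of [u] in [Z], which is even. *)
  have /negbTE Zu := Zev u; rewrite -[RHS]Zu.
  transitivity (\big[addb/false]_c \big[addb/false]_v ((c == a u v) && z u v)).
    apply: eq_bigr => c _; rewrite /dem; case: (boolP (c \in B u)) => [cu|cu] /=;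
      first exact: s0deg.
    rewrite big1 // => v _; apply/negP => /andP[/eqP cE /zl uv].
    by move: cu; rewrite cE; have [-> _] := aP (linked_edge uv).
  by rewrite exchange_big /=; apply: eq_bigr => v _; rewrite addb_sum_pred1.
have [J JP] := fin_all_exists join.
exists (fun c d => s0 c d (+) \big[addb/false]_u J u c d); split.
- move=> c d /=; rewrite s0sym; congr (_ (+) _); apply: eq_bigr => u _.
  by have [Js _ _] := JP u.
- move=> c d; case s0cd: (s0 c d); first by move=> _; apply: s0k.
  rewrite addFb => H; have [u Ju] : exists u, J u c d.
    by apply/existsP; apply: contraTT H => /existsPn H; rewrite big1 // => u _;
      apply/negbTE.
  have [_ Ji _] := JP u; have /and3P[h1 h2 h3] := Ji _ _ Ju.
  by rewrite /kept h1; apply/orP; left; apply/existsP; exists u; rewrite h2 h3.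
- move=> c; rewrite big_split /= exchange_big /=.
  rewrite [X in _ (+) X](eq_bigr (fun u => dem u c)); last by move=> u _;
    have [_ _ ->] := JP u.
  rewrite /dem.
  have [/existsP[u cu]|/existsPn no] := boolP [exists u, c \in B u].
    rewrite (bigD1 u) //= cu /= [X in _ (+) (_ (+) X)]big1 ?addbF ?addbb // => w wu.
    by apply/negP => /andP[/(blob_uniq cu) uw _]; rewrite uw eqxx in wu.
  rewrite [X in _ (+) X]big1 ?addbF; last by move=> u _; rewrite (negbTE (no u)).
  rewrite big1 // => d _; apply/existsP => -[x /existsP[y /and3P[/zl h1 /eqP cE _]]].
  by move: (no x); rewrite cE; have [-> _] := aP (linked_edge h1).
move=> x y xy; have exy := linked_edge xy.
have [axy ad] := aP exy; have ayx : a y x \in B y by apply: link_in; rewrite esym.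
rewrite [X in _ (+) X]big1 ?addbF; last first.
  move=> u _; apply/negP; have [_ Ji _] := JP u; move=> /Ji /and3P[_ h1 h2].
  by move: (edge_neq exy); rewrite (blob_uniq axy h1) (blob_uniq ayx h2) eqxx.
apply/idP/idP => [|zxy]; last first.
  by apply/existsP; exists x; apply/existsP; exists y; rewrite /z zxy !eqxx.
case/existsP => x' /existsP[y' /and3P[zxy /eqP h2 /eqP h3]].
have [k1 _] := aP (linked_edge (zl _ _ zxy)).
have k2 : a y' x' \in B y' by apply: link_in; rewrite esym; apply: linked_edge; apply: zl.
rewrite -h2 in k1; rewrite -h3 in k2.
by rewrite (blob_uniq axy k1) (blob_uniq ayx k2).
Qed.

(** A cell is encoded by the grid point at its lower left corner. *)
Definition sd1 (c d : Pt) : Pt := gp N (sides c d).1.1 (sides c d).1.2.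
Definition sd2 (c d : Pt) : Pt := gp N (sides c d).2.1 (sides c d).2.2.

(** Dual adjacency: one may pass between neighbouring cells across an edge that is not kept. The
    classes of [connect crossing] play the role of faces. *)
Definition crossing : rel Pt := fun p q =>
  [exists c, exists d, [&& adj c d, inner c, ~~ kept c d &
    ((p == sd1 c d) && (q == sd2 c d)) || ((q == sd1 c d) && (p == sd2 c d))]].

Lemma crossing_sym : connect_sym crossing.
Proof.
apply: sym_connect_sym => p q; rewrite /crossing.
by apply: eq_existsb => c; apply: eq_existsb => d; rewrite orbC.
Qed.

Definition face_bd (p : Pt) :
  rel Pt := cell_bd (fun k => connect crossing p (gp N k.1 k.2)).

Lemma face_bdE p c d : face_bd p c d =
  adj c d && (connect crossing p (sd1 c d) (+) connect crossing p (sd2 c d)).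
Proof. by []. Qed.

(** The two cells along an edge that is not kept are in the same class, so the edge is not on its
    boundary. *)
Lemma face_bd_kept p c d : inner c -> face_bd p c d -> kept c d.
Proof.
move=> ic; rewrite face_bdE => /andP[cd]; apply: contraLR => nk.
have cr : connect crossing (sd1 c d) (sd2 c d).
  by apply: connect1; apply/existsP; exists c; apply/existsP; exists d;
    rewrite cd ic nk !eqxx.
by rewrite (same_connect_r crossing_sym cr) addbb.
Qed.

Definition face_edges (p : Pt) : {set {set T}} :=
  [set f in A | [exists x, exists y, (f == [set x; y]) && face_bd p (a x y) (a y x)]].

Lemma mem_face_edges p x y :
  ([set x; y] \in face_edges p) = linked x y && face_bd p (a x y) (a y x).
Proof.
rewrite inE -/(linked x y); case: (boolP (linked x y)) => //= xy.
apply/existsP/idP => [[x' /existsP[y' /andP[/eqP/set2_inj [[-> ->]|[-> ->]] //]]]|h].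
  by rewrite /face_bd cell_bd_sym.
by exists x; apply/existsP; exists y; rewrite eqxx.
Qed.

Lemma face_edges_sub p : face_edges p \subset A.
Proof. by apply/subsetP => f; rewrite inE => /andP[]. Qed.

Lemma face_edges_even p : even_set (face_edges p).
Proof.
rewrite even_relE ?(subset_trans (face_edges_sub p)) //; apply/forallP => u.
under eq_bigr => v _ do rewrite mem_face_edges.
rewrite kept_project //.
- exact: cell_bd_sym.
- by move=> c; rewrite face_bdE /grid_adj !(gtn_eqF (ltnSn _)) !andbF.
- by move=> c d cu; apply: face_bd_kept; apply: (gm_inner gm cu).
- by move=> c cu; apply: cell_bd_even; apply: (gm_inner gm cu).
Qed.

(** One boundary per root, that is per face. As a set of sets it identifies faces with equal
    boundaries, such as the two sides of a single cycle. *)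
Definition face_sets : {set {set {set T}}} :=
  [set face_edges p | p in [pred p | roots crossing p]] :\ set0.

(** Only the faces of the two cells along the link of [f] can have [f] on their boundary. *)
Lemma face_sets_two f : #|[set C in face_sets | f \in C]| <= 2.
Proof.
have [fA|fA] := boolP (f \in A); last first.
  rewrite (_ : [set _ in _ | _] = set0) ?cards0 //; apply/setP => C; rewrite !inE.
  apply/negP => /andP[/andP[_ /imsetP[p _ ->]] fp].
  by case/negP: fA; apply: (subsetP (face_edges_sub p)).
have [x [y [exy fE]]] := gedges_ex (subsetP Asub f fA).
pose c := a x y; pose d := a y x.
have L : #|[set face_edges (fingraph.root crossing (sd1 c d));
  face_edges (fingraph.root crossing (sd2 c d))]| <= 2.
  by rewrite cards2; case: (_ != _).
apply: leq_trans L.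
apply/subset_leq_card/subsetP => C; rewrite !inE => /andP[/andP[_ /imsetP[p /= rp ->]]].
rewrite fE mem_face_edges => /andP[_]; rewrite face_bdE -/c -/d => /andP[_].
have rt q : connect crossing p q -> p = fingraph.root crossing q.
  by move=> pq; rewrite -(fingraph.rootP crossing_sym pq); apply/eqP; rewrite eq_sym.
case h1: (connect crossing p (sd1 c d)); first by rewrite -(rt _ h1) eqxx.
by rewrite addFb => /rt <-; rewrite eqxx orbT.
Qed.

(** Lift [Z] to an even set of grid edges and write it as the boundary of a set [w] of cells. Since
    the lift uses only kept edges, [w] is a union of faces, and [Z] is the sum of their
    boundaries. *)
Lemma face_sets_span (Z : {set {set T}}) : Z \subset A -> even_set Z ->
  exists2 Q : {set {set {set T}}}, Q \subset face_sets &
    forall f, (f \in Z) = odd #|[set C in Q | f \in C]|.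
Proof.
move=> ZA Zev; have [s [ss sk se sZ]] := kept_lift ZA Zev.
have [w wP] := even_cell_bd ss (fun c d h => proj1 (andP (sk c d h)))
  (fun c d h => kept_inner (sk c d h)) se.
pose wc (p : Pt) := w (p.1 : nat, p.2 : nat).
have gpK (c : Pt) k1 k2 : k1 <= N -> k2 <= N -> wc (gp N k1 k2) = w (k1, k2).
  by move=> h1 h2; rewrite /wc /= !inordK.
have sidesN (c d : Pt) : [&& (sides c d).1.1 <= N, (sides c d).1.2 <= N,
  (sides c d).2.1 <= N & (sides c d).2.2 <= N].
  by move: (ltn_ord c.1) (ltn_ord c.2) (ltn_ord d.1) (ltn_ord d.2); rewrite /sides;
    case: eqP => _ /=; lia.
have wbd c d : inner c -> s c d = adj c d && (wc (sd1 c d) (+) wc (sd2 c d)).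
  move=> ic; rewrite wP // /cell_bd; have /and4P[h1 h2 h3 h4] := sidesN c d.
  by rewrite /sd1 /sd2 !gpK //; case: (sides c d) => -[? ?] [? ?].
(* A step of [crossing] passes an edge outside [kept], hence outside [s], and so does not change
   [w]. *)
have wconn p q : connect crossing p q -> wc p = wc q.
  case/connectP => r; elim: r p => [|x r IH] p /=; first by move=> _ ->.
  move=> /andP[px pr] lq; rewrite -(IH x pr lq).
  case/existsP: px => c /existsP[d /and4P[cd ic nk H]].
  have : s c d = false by apply/negP => /sk; apply/negP.
  rewrite wbd // cd /= => /negbT; rewrite negb_add => /eqP E.
  by case/orP: H => /andP[/eqP-> /eqP->].
pose S := [set p | roots crossing p && wc p].
have Zsum f : (f \in Z) = \big[addb/false]_(p in S) (f \in face_edges p).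
  have [fA|fA] := boolP (f \in A); last first.
    rewrite big1; first by apply/negP => /(subsetP ZA); apply/negP.
    by move=> p _; apply/negP => /(subsetP (face_edges_sub p)); apply/negP.
  have [x [y [exy fE]]] := gedges_ex (subsetP Asub f fA).
  have xy : linked x y by rewrite /linked -fE.
  have ic : inner (a x y) by apply: (gm_inner gm (link_in exy)).
  rewrite fE -sZ // wbd //.
  have [_ ad] := aP exy; rewrite ad /=.
  (* Each cell [q] is connected to exactly one root, and [wc] agrees there with [wc q]. *)
  have sumw q : \big[addb/false]_(p in S) connect crossing p q = wc q.
    rewrite big_mkcond /= (bigD1 (fingraph.root crossing q)) //= inE roots_root;
      last exact: crossing_sym.
    rewrite -(wconn _ _ (connect_root crossing q)) big1 => [|p pq].
      rewrite addbF crossing_sym connect_root /=; by case: (wc q).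
    case: ifP => //; rewrite inE => /andP[rp _]; apply/negP => cpq.
    by move: pq; rewrite -(fingraph.rootP crossing_sym cpq) (eqP rp) eqxx.
  rewrite -!sumw -big_split /=; apply: eq_bigr => p _.
  by rewrite mem_face_edges xy face_bdE ad.
(* Several faces may share the boundary [C]; it is selected when an odd number of them lie in
   [S]. *)
exists [set C in face_sets | odd #|[set p in S | face_edges p == C]|].
  by apply/subsetP => C; rewrite inE => /andP[].
move=> f; rewrite Zsum odd_cardE.
transitivity (\big[addb/false]_C \big[addb/false]_(p in S)
  ((C == face_edges p) && (f \in C))); last first.
  apply: eq_bigr => C _; rewrite !inE odd_cardE.
  have [fC|fC] := boolP (f \in C); last by rewrite andbF big1 // => p _; rewrite andbF.
  have [/imsetP[p0 rp0 CE]|no] :=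
    boolP (C \in [set face_edges p | p in [pred p | roots crossing p]]).
    rewrite andbT andbT (_ : C != set0) /=; last by apply/set0Pn; exists f.
    by rewrite big_mkcond /=; apply: eq_bigr => p _; rewrite !inE andbT eq_sym; case: ifP.
  rewrite !andbF /= big1 // => p; rewrite inE => /andP[rp _];
    apply/negP => /andP[/eqP CE _].
  by case/negP: no; rewrite CE; apply: imset_f.
rewrite exchange_big /=; apply: eq_bigr => p _.
by rewrite addb_sum_pred1.
Qed.
End MacLane.

(* One half of MacLane's planarity criterion. *)
Theorem grid_minor_faces (T : finType) (e : rel T) N (B : T -> {set 'I_N.+1 * 'I_N.+1})
    (A : {set {set T}}) :
  simple_graph e -> grid_minor e B -> A \subset gedges e ->
  exists F : {set {set {set T}}},
  [/\ forall C, C \in F -> [/\ C \subset A, C != set0 & even_set C],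
      forall f, #|[set C in F | f \in C]| <= 2 &
      forall Z : {set {set T}}, Z \subset A -> even_set Z ->
        exists2 Q : {set {set {set T}}}, Q \subset F &
          forall f, (f \in Z) = odd #|[set C in Q | f \in C]|].
Proof.
move=> sg gm As; have [a aP] := links_exist sg gm.
exists (face_sets B a A); split.
- move=> C; rewrite !inE => /andP[C0 /imsetP[p _ CE]]; split => //; rewrite CE.
    exact: face_edges_sub.
  exact: (face_edges_even sg gm aP As).
- exact: (face_sets_two B a As).
- exact: (face_sets_span sg gm aP As).
Qed.

(** * Dimension of the cycle space *)

Definition symd (P : finType) (A B : {set P}) :
  {set P} := [set x | (x \in A) (+) (x \in B)].

Lemma odd_symd (P : finType) (A B : {set P}) (p : pred P) :
  odd #|[set x in symd A B | p x]| = odd #|[set x in A | p x]| (+) odd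
    #|[set x in B | p x]|.
Proof.
rewrite !odd_cardE -big_split /=; apply: eq_bigr => x _; rewrite !inE.
by case: (x \in A); case: (x \in B); case: (p x).
Qed.

Lemma symd_even (T : finType) (C D : {set {set T}}) : even_set C -> even_set D ->
  even_set (symd C D).
Proof.
move=> /forallP hC /forallP hD; apply/forallP => u.
by rewrite odd_symd (negbTE (hC u)) (negbTE (hD u)).
Qed.

Lemma symdK (P : finType) (A B : {set P}) : symd (symd A B) B = A.
Proof. by apply/setP => x; rewrite !inE -addbA addbb addbF. Qed.

Lemma card_fibers (P Q : finType) (S : {set P}) (g : P -> Q) (m : nat) :
  (forall q, #|[set x in S | g x == q]| <= m) -> #|S| <= m * #|g @: S|.
Proof.
move=> H; rewrite -sum1_card (partition_big g [in g @: S]) /=; last by move=> x xS;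
  apply: imset_f.
rewrite mulnC -sum_nat_const; apply: leq_sum => q _.
by rewrite sum1_card; apply: leq_trans (H q); apply/subset_leq_card/subsetP => x;
  rewrite !inE.
Qed.

Section CycleCount.
Variables (T : finType) (e : rel T) (U : {set T}) (A : {set {set T}}).
Hypothesis (esg : simple_graph e) (Asub : A \subset gedges e)
  (AU : forall f, f \in A -> f \subset U).

(** The boundary map modulo 2, whose kernel is the cycle space. *)
Definition odd_verts (C : {set {set T}}) :
  {set T} := [set u | odd #|[set f in C | u \in f]|].

Lemma odd_verts_sub (C : {set {set T}}) : C \subset A -> odd_verts C \subset U.
Proof.
move=> CA; apply/subsetP => u; rewrite inE => od.
have /card_gt0P[f] : 0 < #|[set f in C | u \in f]| by case: (#|_|) od.
by rewrite inE => /andP[fC uf]; apply: (subsetP (AU (subsetP CA f fC))).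
Qed.

Lemma odd_verts_card (C : {set {set T}}) : C \subset A -> ~~ odd #|odd_verts C|.
Proof.
move=> CA; rewrite odd_cardE.
have CG : C \subset gedges e by apply: subset_trans Asub.
under eq_bigr => u _ do rewrite inE (odd_degE _ esg CG).
have := @addb_sum_square _ (fun u v => [set u; v] \in C) setT.
under eq_bigr => u _ do under eq_bigl => v do rewrite inE.
under eq_bigl => u do rewrite inE.
move=> -> //.
- by move=> u v /=; rewrite setUC.
- move=> u /=; apply/negP => /(subsetP CG); case: esg => es ei; rewrite gedgesP // ei //.
Qed.

(** The parity of [S] decides whether [r] belongs to it, so deleting [r] is injective on even
    subsets. *)
Lemma card_even_subsets (r : T) : r \in U ->
  #|[set S : {set T} | (S \subset U) && ~~ odd #|S|]| <= 2 ^ #|U|.-1.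
Proof.
move=> rU; set X := [set S : {set T} | _].
have inj : {in X &, injective (fun S : {set T} => S :\ r)}.
  move=> S S'; rewrite !inE => /andP[_ o1] /andP[_ o2] E.
  have rr : (r \in S) = (r \in S').
    by move: o1 o2; rewrite (cardsD1 r S) (cardsD1 r S') E !oddD; case: (r \in S);
      case: (r \in S'); case: (odd #|_|).
  apply/setP => x; have [->//|xr] := eqVneq x r.
  by move/setP/(_ x): E; rewrite !inE xr.
rewrite -(card_in_imset inj) (cardsD1 r U) rU /= -card_powerset.
apply/subset_leq_card/subsetP => X0 /imsetP[S]; rewrite inE => /andP[SU _] ->.
by rewrite inE setSD.
Qed.

(** Rank and nullity by counting: a nonempty fibre of [odd_verts] is a translate of the cycle space,
    and the image consists of even subsets of [U]. *)
Lemma cycle_space_card : U != set0 ->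
  2 ^ #|A| <= #|[set Z in powerset A | even_set Z]| * 2 ^ #|U|.-1.
Proof.
case/set0Pn => r rU; rewrite -card_powerset.
apply: (@leq_trans (#|[set Z in powerset A | even_set Z]| * #|odd_verts @: powerset A|)).
  apply: card_fibers => q.
  case: (set_0Vmem [set x in powerset A | odd_verts x == q]) => [->|[C0]];
    first by rewrite cards0.
  rewrite !inE => /andP[C0A /eqP C0q].
  have inj : injective (fun C => symd C C0).
    by move=> C C' E; rewrite -(symdK C C0) E symdK.
  rewrite -(card_imset _ inj).
  apply/subset_leq_card/subsetP => X0 /imsetP[C]; rewrite !inE => /andP[CA /eqP Cq] ->.
  apply/andP; split.
    apply/subsetP => f; rewrite inE; case fC: (f \in C); first by move=> _;
      apply: (subsetP CA).
    by rewrite addFb; apply: (subsetP C0A).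
  apply/forallP => u; rewrite odd_symd.
  by move: (Cq); rewrite -C0q => /setP/(_ u); rewrite !inE => ->; rewrite addbb.
rewrite leq_mul2l; apply/orP; right; apply: leq_trans (card_even_subsets rU).
apply/subset_leq_card/subsetP => X0 /imsetP[C]; rewrite powersetE => CA ->.
by rewrite inE odd_verts_sub // odd_verts_card.
Qed.

(** Spanning bounds the cycle space by the number of subfamilies of [F]; the exponents in
    [cycle_space_card] are then compared. *)
Lemma face_count (F : {set {set {set T}}}) : U != set0 ->
  (forall Z : {set {set T}}, Z \subset A -> even_set Z ->
        exists2 Q : {set {set {set T}}}, Q \subset F &
          forall f, (f \in Z) = odd #|[set C in Q | f \in C]|) ->
  #|A| + 1 <= #|F| + #|U|.
Proof.
move=> U0 span.
have H : #|[set Z in powerset A | even_set Z]| <= 2 ^ #|F|.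
  rewrite -card_powerset.
  apply: leq_trans (leq_imset_card
    (fun Q : {set {set {set T}}} => [set f | odd #|[set C in Q | f \in C]|]) _).
  apply/subset_leq_card/subsetP => Z; rewrite !inE => /andP[ZA Zev].
  have [Q QF QE] := span Z ZA Zev; apply/imsetP; exists Q; first by rewrite inE.
  by apply/setP => f; rewrite inE.
have := leq_trans (cycle_space_card U0) (leq_mul H (leqnn _)).
rewrite -expnD leq_exp2l //.
have : 0 < #|U| by rewrite card_gt0.
lia.
Qed.
End CycleCount.

(** * Small even sets and discharging *)

Lemma ordS2_neq k (i : 'I_k) : 3 <= k -> ordS (ordS i) != i.
Proof.
move=> k3; rewrite -val_eqE /=; have ik := ltn_ord i.
have [lt|ge] := ltnP i.+1 k.
  rewrite (modn_small lt); have [lt2|ge2] := ltnP i.+2 k;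
    first by rewrite modn_small //; lia.
  have -> : i.+2 = k by lia.
  by rewrite modnn; lia.
have -> : i.+1 = k by lia.
by rewrite modnn modn_small; lia.
Qed.

Section Cycles.
Variables (T : finType) (e : rel T).
Hypothesis esg : simple_graph e.

Lemma cycle_edge_inj k (f : 'I_k -> T) : 3 <= k -> injective f ->
  injective (fun i => [set f i; f (ordS i)]).
Proof.
move=> k3 fi i j /set2_inj [[/fi //]|[/fi h1 /fi h2]].
by have := ordS2_neq i k3; rewrite h2 -h1 eqxx.
Qed.

Lemma cycle_card k C : is_cycle e k C -> #|C| = k.
Proof.
by case=> k3 [f [fi [_ ->]]]; rewrite card_imset ?card_ord //; apply: cycle_edge_inj.
Qed.

Lemma cycle_even k C : is_cycle e k C -> even_set C.
Proof.
case=> k3 [f [fi [fe ->]]]; apply/forallP => u.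
have -> : [set g in [set [set f i; f (ordS i)] | i : 'I_k] | u \in g] =
    (fun i => [set f i; f (ordS i)]) @: [set i | u \in [set f i; f (ordS i)]].
  apply/setP => g; rewrite inE; apply/andP/imsetP => [[/imsetP[i _ ->] ui]|[i]].
    by exists i; rewrite ?inE in ui *.
  by rewrite inE => ui ->; split => //; apply: imset_f.
rewrite card_imset; last exact: cycle_edge_inj.
rewrite odd_cardE (eq_bigr (fun i => (u == f i) (+) (u == f (ordS i)))); last first.
  move=> i _; rewrite !inE.
  have : f i != f (ordS i) by apply: contraTneq (fe i) => <-; case: esg => _ ->.
  by move=> /negbTE fne; case: (u =P f i) => [->|_]; rewrite ?fne.
by rewrite big_split /= [X in X (+) _](reindex_inj (@ordS_inj k)) addbb.
Qed.

Lemma seq_cycle_is_cycle (r : rel T) (x : T) (q : seq T) :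
  (forall u v, r u v -> e u v) -> cycle r (x :: q) -> uniq (x :: q) -> 2 <= size q ->
  exists2 K, is_cycle e (size q).+1 K &
    forall g, g \in K -> exists u v, r u v /\ g = [set u; v].
Proof.
move=> re cyc uq sq; pose k := (size q).+1.
pose f (i : 'I_k) := nth x (x :: q) i.
have rf i : r (f i) (f (ordS i)).
  have /= /(pathP x)/(_ i) := cyc; rewrite size_rcons ltn_ord => /(_ isT).
  rewrite /f /= -rcons_cons nth_rcons /= ltn_ord nth_rcons.
  have [lt|ge] := ltnP i (size q); first by rewrite modn_small.
  have ie : i = size q :> nat by apply/eqP; rewrite eqn_leq ge andbT -ltnS;
    exact: (ltn_ord i).
  by rewrite ie eqxx modnn.
exists [set [set f i; f (ordS i)] | i : 'I_k].
  split; first by rewrite /k ltnS.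
  exists f; split; last by split => // i; apply: re.
  move=> i j /eqP; rewrite /f nth_uniq ?ltn_ord // => /eqP; exact: val_inj.
by move=> g /imsetP[i _ ->]; exists (f i), (f (ordS i)).
Qed.

(** Extend a path at its front as long as possible. Evenness supplies a second edge at the front
    vertex, and finiteness forces it back onto the path, which closes a cycle. *)
Lemma even_has_cycle (C : {set {set T}}) : C \subset gedges e -> even_set C ->
  C != set0 ->
  exists k K, is_cycle e k K /\ K \subset C.
Proof.
move=> CG Cev /set0Pn[g gC].
pose r u v := [set u; v] \in C.
have rs : symmetric r by move=> u v; rewrite /r setUC.
have re u v : r u v -> e u v by move=> /(subsetP CG); rewrite gedgesP //; case: esg.
have other u v : r u v -> exists2 w, w != v & r u w.
  move=> uv; move/forallP/(_ u): Cev; rewrite (odd_degE _ esg CG) => ev.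
  have [/existsP[w /andP[h1 h2]]|/existsPn no] := boolP [exists w, (w != v) && r u w];
    first by exists w.
  case/negP: ev; rewrite (bigD1 v) //= -/(r u v) uv big1 // => w wv.
  by apply/negbTE; move: (no w); rewrite wv.
(* The path has [size p + 2] vertices, so [n] bounds the number of extensions left. *)
suff H n x y p : path r x (y :: p) -> uniq (x :: y :: p) -> #|T| <= n + size p ->
    exists k K, is_cycle e k K /\ K \subset C.
  have [u [v [euv gE]]] := gedges_ex (subsetP CG g gC).
  apply: (H #|T| u v [::]) => /=; rewrite ?addn0 // ?andbT ?inE.
    by rewrite /r -gE.
  by apply: contraTneq euv => ->; case: esg => _ ->.
elim: n x y p => [|n IH] x y p pp up sz.
  have := leq_trans (max_card (mem (x :: y :: p))) sz.
  by rewrite (card_uniqP up) /= add0n ltnNge leqnSn.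
have xy : r x y by case/andP: pp.
have [w wy xw] := other _ _ xy.
have [wp|wp] := boolP (w \in x :: y :: p); last first.
  apply: (IH w x (y :: p)) => /=.
  - by rewrite rs xw.
  - by rewrite wp.
  - by rewrite addnS -addSn.
have wx : w != x by apply: contraTneq (re _ _ xw) => ->; case: esg => _ ->.
move: wp; rewrite !inE (negbTE wx) (negbTE wy) /= => wp.
case/splitPr: wp pp up => p1 p2 pp up {sz}.
have pq : path r x (y :: rcons p1 w) by move: pp;
  rewrite -cat_rcons /= cat_path andbA => /andP[].
have uq : uniq (x :: y :: rcons p1 w).
  by move: up; rewrite -cat_rcons -!cat_cons cat_uniq => /andP[].
have [||K Kc KC] := @seq_cycle_is_cycle r x (y :: rcons p1 w) re _ uq.
- by rewrite /cycle rcons_path pq /= last_rcons rs xw.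
- by rewrite /= size_rcons.
exists (size (y :: rcons p1 w)).+1, K; split => //.
by apply/subsetP => h /KC [u [v [ruv ->]]].
Qed.

Lemma even_card_ge3 (C : {set {set T}}) : C \subset gedges e -> even_set C -> C != set0 ->
  3 <= #|C|.
Proof.
move=> CG Cev C0; have [k [K [Kc KC]]] := even_has_cycle CG Cev C0.
by apply: leq_trans (subset_leq_card KC); rewrite (cycle_card Kc); case: Kc.
Qed.

(** Remove a cycle contained in [C]: what remains is even and has at most two edges, hence is
    empty. *)
Lemma small_even_cycle (C : {set {set T}}) : C \subset gedges e -> even_set C ->
  C != set0 ->
  #|C| <= 5 -> is_cycle e #|C| C.
Proof.
move=> CG Cev C0 C5; have [k [K [Kc KC]]] := even_has_cycle CG Cev C0.
have DE : symd C K = C :\: K.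
  apply/setP => g; rewrite !inE; case gK: (g \in K); last by rewrite addbF.
  by rewrite (subsetP KC _ gK).
have Dev : even_set (C :\: K) by rewrite -DE; apply: symd_even => //;
  apply: cycle_even Kc.
have cK := cycle_card Kc; have k3 : 3 <= k by case: Kc.
have cD : #|C :\: K| = #|C| - k by rewrite cardsD (setIidPr KC) cK.
have [D0|D0] := eqVneq (C :\: K) set0.
  have <- : K = C by apply/eqP; rewrite eqEsubset KC -setD_eq0 D0 eqxx.
  by rewrite cK.
have := even_card_ge3 (subset_trans (subsetDl _ _) CG) Dev D0.
by rewrite cD; lia.
Qed.
End Cycles.

Lemma card_symd (P : finType) (A B : {set P}) : #|symd A B| + 2 * #|A :&:
  B| = #|A| + #|B|.
Proof.
have -> : symd A B = (A :\: B) :|: (B :\: A).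
  by apply/setP => x; rewrite !inE; case: (x \in A); case: (x \in B).
rewrite cardsU (_ : _ :&: _ = set0); last first.
  by apply/setP => x; rewrite !inE; case: (x \in A); case: (x \in B).
rewrite cards0 subn0 !cardsD [B :&: A]setIC.
have := subset_leq_card (subsetIl A B); have := subset_leq_card (subsetIr A B); lia.
Qed.

Section Discharge.
Variables (T : finType) (e : rel T) (A : {set {set T}}) (F : {set {set {set T}}}).
Hypothesis esg : simple_graph e.
Hypothesis no_adj : forall C D : {set {set T}}, is_cycle e 3 C ->
     (is_cycle e 3 D \/ is_cycle e 4 D) -> ~ adjacent_cycles C D.
Hypothesis five : forall D : {set {set T}}, is_cycle e 5 D ->
     forall S : {set {set {set T}}},
       (forall C, C \in S -> is_cycle e 3 C /\ adjacent_cycles C D) -> #|S| <= 3.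
Hypothesis Asub : A \subset gedges e.
Hypothesis FP : forall C, C \in F -> [/\ C \subset A, C != set0 & even_set C].
Hypothesis F2 : forall f, #|[set C in F | f \in C]| <= 2.

(* Each edge holds 6 units; a triangular face takes 4 of them, leaving 2. *)
Definition charge (C : {set {set T}}) (f : {set T}) : nat :=
  if #|C| == 3 then 4 else if [exists D in F, (#|D| == 3) && (f \in D)] then 2 else 3.

Lemma face_cycle C : C \in F -> #|C| <= 5 -> is_cycle e #|C| C.
Proof.
move=> CF; have [CA C0 Cev] := FP CF; apply: small_even_cycle => //.
exact: subset_trans Asub.
Qed.

Lemma face_triangle C : C \in F -> #|C| == 3 -> is_cycle e 3 C.
Proof. by move=> CF /eqP C3; rewrite -C3; apply: face_cycle; rewrite ?C3. Qed.

(** If two edges were shared, the symmetric difference would be an even set of four edges, a 4-cycle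
    adjacent to the triangle [D] along its third edge. Three shared edges would leave a nonempty
    even set of only two edges. *)
Lemma pentagon_meets C D : C \in F -> D \in F -> #|C| = 5 -> #|D| == 3 -> #|C :&: D| <= 1.
Proof.
move=> CF DF C5 D3; rewrite leqNgt; apply/negP => gt1.
have [CA C0 Cev] := FP CF; have [DA D0 Dev] := FP DF.
have cE := card_symd C D; rewrite C5 (eqP D3) in cE.
have sub : symd C D \subset gedges e.
  apply: subset_trans Asub; apply/subsetP => f; rewrite inE; case fC: (f \in C).
    by move=> _; apply: (subsetP CA).
  by rewrite addFb; apply: (subsetP DA).
have ID : #|C :&: D| <= 3 by rewrite -(eqP D3); apply/subset_leq_card/subsetIr.
have [pos four diff] : [/\ 0 < #|symd C D|, 3 <= #|symd C D| -> #|symd C D| = 4 &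
    #|symd C D| = 4 -> 0 < 3 - #|C :&: D|].
  by move: #|symd C D| #|C :&: D| cE gt1 ID; clear=> *; split; lia.
have S0 : symd C D != set0 by rewrite -card_gt0.
have Sev : even_set (symd C D) by apply: symd_even.
have S3 := even_card_ge3 esg sub Sev S0.
have S4 := four S3.
have := small_even_cycle esg sub Sev S0; rewrite S4 => /(_ isT) cyc4.
apply: (no_adj (face_triangle DF D3) (or_intror cyc4)); split.
  by move=> E; move: S4; rewrite -E (eqP D3).
have [g] : exists g, g \in D :\: C.
  by apply/card_gt0P; rewrite cardsD setIC (eqP D3); apply: diff.
by rewrite inE => /andP[gC gD]; exists g; rewrite inE gD (negbTE gC).
Qed.

(** By size: a triangle gets 3 times 4; a 4-cycle meets no triangular face and gets 4 times 3; a
    5-cycle gets 15 less at most 3; with six or more edges, 2 from each suffices. *)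
Lemma charge_face C : C \in F -> 12 <= \sum_(f in C) charge C f.
Proof.
move=> CF; have [CA C0 Cev] := FP CF.
have CG : C \subset gedges e by apply: subset_trans Asub.
have C3 := even_card_ge3 esg CG Cev C0.
have [c3|c3] := boolP (#|C| == 3).
  rewrite (eq_bigr (fun=> 4)) => [|f _]; last by rewrite /charge c3.
  by rewrite sum_nat_const (eqP c3).
pose near_tri f := [exists D in F, (#|D| == 3) && (f \in D)].
have chE f : charge C f = if near_tri f then 2 else 3 by rewrite /charge (negbTE c3).
have tri_adj f D : f \in C -> D \in F -> #|D| == 3 -> f \in D ->
  is_cycle e 3 D /\ adjacent_cycles D C.
  move=> fC DF D3 fD; split; first exact: face_triangle.
  by split; [move=> E; rewrite -E D3 in c3 | exists f].
have [C6|C6] := leqP 6 #|C|.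
  apply: (@leq_trans (\sum_(f in C) 2)); first by rewrite sum_nat_const; lia.
  by apply: leq_sum => f _; rewrite chE; case: ifP.
have cyc := face_cycle CF C6.
have [c4|c4] := eqVneq #|C| 4.
  rewrite (eq_bigr (fun=> 3)) => [|f fC]; first by rewrite sum_nat_const c4.
  rewrite chE; case: ifP => // /exists_inP[D DF /andP[D3 fD]].
  have [k1 k2] := tri_adj f D fC DF D3 fD; rewrite c4 in cyc.
  by case: (no_adj k1 (or_intror cyc) k2).
have c5 : #|C| = 5 by move: c3 c4 => /eqP ? /eqP ?; lia.
pose X := [set f in C | near_tri f].
have X3 : #|X| <= 3.
  pose tri f := odflt set0 [pick D in F | (#|D| == 3) && (f \in D)].
  have triP f : f \in X -> [/\ f \in C, tri f \in F, #|tri f| == 3 & f \in tri f].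
    rewrite inE /tri => /andP[fC /exists_inP[D DF D3]];
      case: pickP => [D' /and3P[h1 h2 h3] //|no].
    by have := no D; rewrite DF D3.
  (* By [pentagon_meets] distinct edges of [C] get distinct triangles, so the bound of three on
     triangles bounds [X]. *)
  have inj : {in X &, injective tri}.
    move=> f g /triP[fC fF f3 ff] /triP[gC gF g3 gg] E; rewrite -E in gg.
    have /card_le1P : #|C :&: tri f| <= 1 by apply: pentagon_meets.
    move=> /(_ f); rewrite inE fC ff => /(_ isT g).
    by rewrite !inE gC gg => /esym/eqP.
  rewrite -(card_in_imset inj); rewrite c5 in cyc;
    apply: (five cyc) => D /imsetP[f /triP[fC fF f3 ff] ->].
  exact: tri_adj ff.
have tot : \sum_(f in C) charge C f + \sum_(f in C) (near_tri f : nat) = 15.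
  rewrite -big_split /= (eq_bigr (fun=> 3)); first by rewrite sum_nat_const c5.
  by move=> f _; rewrite chE; case: ifP.
have XE : \sum_(f in C) (near_tri f : nat) = #|X|.
  rewrite -sum1_card [RHS](eq_bigl (fun f => (f \in C) && near_tri f));
    last by move=> f; rewrite inE.
  by rewrite [RHS]big_mkcondr; apply: eq_bigr => f _; case: (near_tri f).
by rewrite XE in tot; lia.
Qed.

(** By [no_adj] at most one face through [f] is a triangle, and then a second face takes only 2. *)
Lemma charge_edge f : \sum_(C in F | f \in C) charge C f <= 6.
Proof.
rewrite (eq_bigl [in [set C in F | f \in C]]); last by move=> C; rewrite inE.
set S := [set C in F | f \in C].
have [/exists_inP[D DS D3]|no] := boolP [exists D in S, #|D| == 3].
  move: (DS); rewrite inE => /andP[DF fD].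
  have cD : charge D f = 4 by rewrite /charge D3.
  rewrite (big_setD1 D DS) /= cD.
  have H : \sum_(C in S :\ D) charge C f <= \sum_(C in S :\ D) 2.
    apply: leq_sum => C; rewrite !inE => /and3P[CD CF fC]; rewrite /charge.
    case: ifP => [C3|_].
      case: (no_adj (face_triangle CF C3) (or_introl (face_triangle DF D3))).
      by split; [apply/eqP | exists f].
    by case: ifP => // /negbT /exists_inPn /(_ D DF); rewrite D3 fD.
  have S1 : #|S :\ D| <= 1 by have := F2 f; rewrite -/S (cardsD1 D) DS.
  rewrite -[6]/(4 + 2) leq_add2l (leq_trans H) // sum_nat_const.
  by rewrite -[leqRHS]/(1 * 2) leq_mul2r S1.
apply: (@leq_trans (\sum_(C in S) 3)); last by rewrite sum_nat_const; have := F2 f;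
  rewrite -/S; lia.
apply: leq_sum => C CS; rewrite /charge; case: ifP => [C3|_]; last by case: ifP.
by case/negP: no; apply/exists_inP; exists C.
Qed.

(** Double counting of the charge gives [12 |F| <= 6 |A|]. *)
Lemma faces_le : 2 * #|F| <= #|A|.
Proof.
have H : \sum_(C in F) 12 <= \sum_(C in F) \sum_(f in C) charge C f by apply:
  leq_sum => C; apply: charge_face.
have E : \sum_(C in F) \sum_(f in C) charge C f = \sum_(f in A) \sum_(C in F | f \in C)
  charge C f.
  apply: exchange_big_dep => C f CF fC; have [CA _ _] := FP CF; exact: (subsetP CA).
have K : \sum_(f in A) \sum_(C in F | f \in C) charge C f <= \sum_(f in A) 6.
  by apply: leq_sum => f _; apply: charge_edge.
rewrite E in H; have := leq_trans H K; rewrite !sum_nat_const; lia.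
Qed.
End Discharge.

(** * From planar drawings to grid minors *)

Module Arcs.
Import boolp classical_sets functions reals topology normedtype derive Rstruct
  Rstruct_topology.
Import numFieldNormedType.Exports.
Local Open Scope classical_set_scope.
Local Open Scope ring_scope.

Lemma within_cont_dist (R : realType) (f : R -> R) :
  {within [set t : R | 0 <= t <= 1], continuous f} ->
  forall t : R, 0 <= t <= 1 -> forall eps : R, 0 < eps ->
  exists2 delta : R, 0 < delta &
    forall s : R, 0 <= s <= 1 -> `|s - t| < delta -> `|f s - f t| < eps.
Proof.
move=> /subspace_continuousP fc t t01 eps e0.
have /cvgrPdist_lt /(_ _ e0) := fc t t01.
rewrite near_withinE => /nbhs_ballP [d /= d0 H].
exists d => // s s01 st; rewrite distrC; apply: H => //.
by rewrite /ball /= distrC.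
Qed.

Lemma unif_cont (R : realType) (f : R -> R) :
  {within [set t : R | 0 <= t <= 1], continuous f} ->
  forall eps : R, 0 < eps -> exists2 delta : R, 0 < delta &
    forall s t : R, 0 <= s <= 1 -> 0 <= t <= 1 -> `|s - t| < delta -> `|f s - f t| < eps.
Proof.
move=> fc eps e0.
have K : compact (`[0:R, 1]%classic) by exact: segment_compact.
(* The near-covering form of compactness, used with the filter of small positive radii, turns local
   radii into one that works everywhere. *)
move: K => /compact_near_coveringP/near_covering_withinP.
move=> /(_ R (0:R)^'+ (fun d t => forall s : R, 0 <= s <= 1 -> `|s - t| < d ->
  `|f s - f t| < eps) _) [].
  move=> t /=; rewrite in_itv /= => t01.
  have [d d0 H] := within_cont_dist fc t01 (divr_gt0 e0 (ltr0n _ 2)).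
  near=> t' d' => /=; rewrite in_itv /= => t'01 s s01 st'.
  have tt' : `|t' - t| < d / 2.
    rewrite distrC; near: t'; apply: (nbhsx_ballx t (d/2)); lra.
  have dd' : d' < d / 2 by near: d'; apply: nbhs_right_lt; lra.
  have h1 : `|f t' - f t| < eps / 2 by apply: H => //; lra.
  have h2 : `|f s - f t| < eps / 2.
    apply: H => //; have := ler_distD t' s t; lra.
  have := ler_distD (f t) (f s) (f t'). rewrite (distrC (f t)); lra.
move=> d /= d0 H; exists (d / 2); first lra.
move=> s t s01 t01 st; apply: (H (d/2)) => //=; rewrite ?in_itv //=; last lra.
rewrite sub0r normrN gtr0_norm; lra.
Unshelve. all: by end_near.
Qed.

(** Disjoint compact arcs have positive distance in the sup norm; locally one coordinate already
    separates them, and compactness of the parameter rectangle makes the gap uniform. *)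
Lemma arcs_apart (R : realType) (f1 f2 h1 h2 : R -> R) (a b c d : R) :
  0 <= a -> b <= 1 -> 0 <= c -> d <= 1 ->
  {within [set t : R | 0 <= t <= 1], continuous f1} ->
  {within [set t : R | 0 <= t <= 1], continuous f2} ->
  {within [set t : R | 0 <= t <= 1], continuous h1} ->
  {within [set t : R | 0 <= t <= 1], continuous h2} ->
  (forall t s : R, a <= t <= b -> c <= s <= d -> ~ (f1 t = h1 s /\ f2 t = h2 s)) ->
  exists2 delta : R, 0 < delta &
  forall t s : R, a <= t <= b -> c <= s <= d ->
    (delta < `|f1 t - h1 s|) \/ (delta < `|f2 t - h2 s|).
Proof.
move=> a0 b1 c0 d1 cf1 cf2 ch1 ch2 ne.
have : compact (`[a, b]%classic `*` `[c, d]%classic).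
  by apply: compact_setX; exact: segment_compact.
move=> /compact_near_coveringP/near_covering_withinP.
move=> /(_ R (0:R)^'+ (fun r ts => (r < `|f1 ts.1 - h1 ts.2|) \/
  (r < `|f2 ts.1 - h2 ts.2|)) _) [].
  move=> [t s] /= []; rewrite !in_itv /= => tab scd.
  have t01 : 0 <= t <= 1 by lra.
  have s01 : 0 <= s <= 1 by lra.
  (* The hypotheses are symmetric in the two coordinates, so the first may be assumed to differ. *)
  wlog n1 : f1 h1 f2 h2 cf1 cf2 ch1 ch2 ne / f1 t != h1 s.
    move=> W; have [e1|] := eqVneq (f1 t) (h1 s); last by move=> n1; apply: W.
    have n2 : f2 t != h2 s by apply/eqP => e2; case: (ne t s tab scd).
    have {W} := W _ _ _ _ cf2 cf1 ch2 ch1 _ n2.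
    move=> W; apply: filterS (W _) => [[[x1 x2] x3] /= h h'|].
      by case: (h h') => ?; [right|left].
    by move=> u v hu hv [? ?]; apply: (ne u v).
  (* With a third of the gap, moving each point by less than [e] still leaves more than [e] between
     them. *)
  have e0 : 0 < `|f1 t - h1 s| / 3 by rewrite divr_gt0 // normr_gt0 subr_eq0.
  set e := _ / 3 in e0.
  have [d2 d20 H2] := within_cont_dist cf1 t01 e0.
  have [d3 d30 H3] := within_cont_dist ch1 s01 e0.
  near=> t' r => /= -[]; rewrite !in_itv /= => t'ab s'cd; left.
  have [tt' ss'] : (`|t'.1 - t| < d2) /\ (`|t'.2 - s| < d3).
    rewrite distrC (distrC _ s).
    near: t'; exists (ball t d2, ball s d3) => /=.
      by split; apply: nbhsx_ballx.
    by move=> [u v] /= [].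
  have re : r < e by
    near: r; apply: nbhs_right_lt.
  have k1 : `|f1 t'.1 - f1 t| < e by apply: H2 => //; lra.
  have k2 : `|h1 t'.2 - h1 s| < e by apply: H3 => //; lra.
  have ee : `|f1 t - h1 s| = e + e + e by rewrite /e; field.
  have := ler_distD (f1 t'.1) (f1 t) (h1 s).
  have := ler_distD (h1 t'.2) (f1 t'.1) (h1 s).
  rewrite (distrC (f1 t) (f1 _)); lra.
move=> r /= r0 H; exists (r / 2); first lra.
move=> t s tt ss; apply: (H (r/2) _ _ (t, s)) => //=; rewrite ?in_itv //=; last lra.
rewrite sub0r normrN gtr0_norm; lra.
Unshelve. all: by end_near.
Qed.

Lemma arc_bounded (R : realType) (f : R -> R) :
  {within [set t : R | 0 <= t <= 1], continuous f} ->
  exists M : R, forall t, 0 <= t <= 1 -> `|f t| <= M.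
Proof.
move=> fc.
have fc' : {within `[0:R, 1], continuous f}.
  have -> : `[0:R, 1]%classic = [set t : R | 0 <= t <= 1].
    by apply/seteqP; split => t /=; rewrite in_itv.
  exact: fc.
have [c _ Hc] := EVT_max ler01 fc'.
have [d _ Hd] := EVT_min ler01 fc'.
exists (`|f c| + `|f d|) => t t01.
have := Hc t; have := Hd t; rewrite in_itv /= => /(_ t01) h1 /(_ t01) h2.
rewrite ler_norml. have := ler_norm (f c). have := ler_norm (- f d); rewrite normrN.
have := normr_ge0 (f c). have := normr_ge0 (f d). lra.
Qed.

Lemma fin_common_radius (R : realDomainType) (I : finType) (P : I -> R -> Prop) :
  (forall i r r', r' <= r -> P i r -> P i r') ->
  (forall i, exists2 r, 0 < r & P i r) -> exists2 r, 0 < r & forall i, P i r.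
Proof.
move=> mono ex.
suff [r r0 H] : exists2 r, 0 < r & forall i, i \in enum I -> P i r.
  by exists r => // i; apply: H; rewrite mem_enum.
elim: (enum I) => [|i s [r r0 IH]]; first by exists 1.
have [r' r'0 H] := ex i; exists (Num.min r r'); first by rewrite lt_min r0.
move=> j; rewrite inE => /orP[/eqP ->|js].
  by apply: mono H; rewrite ge_min lexx orbT.
by apply: mono (IH _ js); rewrite ge_min lexx.
Qed.
End Arcs.

Module Discretisation.
Import Rstruct.

Definition closeby (r : R) (P Q : R * R) : bool :=
  ((`|P.1 - Q.1| <= r) && (`|P.2 - Q.2| <= r))%R.

(* Metric content of a drawing.  The arc of an edge is cut at the parameters
   1/3 and 2/3, so that its two outer thirds belong to the stars of its ends;
   for a non-edge [x y], [ga x y] is constant. *)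
Record drawing (T : finType) (e : rel T) (ga : T -> T -> R -> R * R) (rho : R) : Prop :=
  Drawing {
  dr_start : forall x y z, ga x y 0%R = ga x z 0%R;
  dr_rev : forall x y t, e x y -> ga y x t = ga x y (1 - t)%R;
  dr_unif : forall x y eps, (0 < eps)%R -> exists2 delta, (0 < delta)%R &
    forall s t, (0 <= s <= 1)%R -> (0 <= t <= 1)%R -> (`|s - t| < delta)%R ->
    closeby eps (ga x y s) (ga x y t);
  dr_bounded : exists M, forall x y t, (0 <= t <= 1)%R -> closeby M (ga x y t) (0, 0)%R;
  dr_rho : (0 < rho)%R;
  dr_stars : forall x y z w s t, x != z -> (0 <= s <= 1/3)%R -> (0 <= t <= 1/3)%R ->
    ~~ closeby rho (ga x y s) (ga z w t);
  dr_mid_star : forall x y z w s t, e x y -> z != x -> z != y ->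
    (1/3 <= s <= 2/3)%R -> (0 <= t <= 1/3)%R -> ~~ closeby rho (ga x y s) (ga z w t);
  dr_mids : forall x y u v s t, e x y -> e u v -> [set x; y] != [set u; v] ->
    (1/3 <= s <= 2/3)%R -> (1/3 <= t <= 2/3)%R -> ~~ closeby rho (ga x y s) (ga u v t) }.

Module PlanarDrawing.
Import boolp classical_sets functions reals topology normedtype derive Rstruct
  Rstruct_topology.
Import numFieldNormedType.Exports.
Local Open Scope classical_set_scope.
Local Open Scope ring_scope.

Lemma closeby_anti (r r' : R) P Q : r' <= r -> ~~ closeby r P Q -> ~~ closeby r' P Q.
Proof.
by move=> rr'; apply: contra => /andP[? ?]; apply/andP; split; apply: le_trans rr'.
Qed.

Lemma planar_drawing (T : finType) (e : rel T) :
  simple_graph e -> planar e -> exists ga rho, drawing e ga rho.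
Proof.
move=> [esym eirr] [p [g [pinj [garc [gvert gdisj]]]]].
(* A non-edge gets a constant curve, so every vertex, even an isolated one, has a star. *)
pose ga x y t := if e x y then g x y t else p x.
have c1 x y : {within [set t : R | 0 <= t <= 1], continuous (fun t => (ga x y t).1)}.
  rewrite /ga; case exy: (e x y); last by move=> ?; exact: cvg_cst.
  have [gc _ _ _ _] := garc _ _ exy.
  by move=> t; apply: cvg_comp; [exact: gc | exact: cvg_fst].
have c2 x y : {within [set t : R | 0 <= t <= 1], continuous (fun t => (ga x y t).2)}.
  rewrite /ga; case exy: (e x y); last by move=> ?; exact: cvg_cst.
  have [gc _ _ _ _] := garc _ _ exy.
  by move=> t; apply: cvg_comp; [exact: gc | exact: cvg_snd].
have ga0 x y : ga x y 0 = p x by rewrite /ga; case: ifP => [/garc[]|].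
have garev x y t : e x y -> ga y x t = ga x y (1 - t).
  by move=> exy; rewrite /ga esym exy; have [] := garc _ _ exy.
have gap x y z t : 0 <= t < 1 -> x != z -> ga x y t <> p z.
  move=> t01 xz; rewrite /ga; case: ifP => [exy|_]; last by move=> /pinj xz0;
    rewrite xz0 eqxx in xz.
  have [->|t0] := eqVneq t 0.
    by have [_ _ -> _ _] := garc _ _ exy; move=> /pinj xz0; rewrite xz0 eqxx in xz.
  by apply: gvert => //; move/eqP: t0 => t0; lra.
have [l0 l13 l23 l13'] : [/\ (0:R) <= 0, (1/3:R) <= 1, (2/3:R) <= 1 & (0:R) <= 1/3] by
  split; lra.
have sep x y z w (a b c d : R) : 0 <= a -> b <= 1 -> 0 <= c -> d <= 1 ->
  (forall s t : R, a <= s <= b -> c <= t <= d -> ga x y s <> ga z w t) ->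
  exists2 r : R, 0 < r & forall s t : R, a <= s <= b -> c <= t <= d ->
    ~~ closeby r (ga x y s) (ga z w t).
  move=> a0 b1 c0 d1 ne.
  have [] := Arcs.arcs_apart a0 b1 c0 d1 (c1 x y) (c2 x y) (c1 z w) (c2 z w).
    by move=> s t hs ht [q1 q2]; apply: (ne s t hs ht); apply: injective_projections.
  move=> r r0 H; exists r => // s t hs ht; rewrite /closeby negb_and -!ltNge.
  by apply/orP; apply: H.
have [] := @Arcs.fin_common_radius R ((T * T) * (T * T))%type (fun i r => forall s t,
     [/\ (i.1.1 != i.2.1 -> 0 <= s <= 1/3 -> 0 <= t <= 1/3 ->
           ~~ closeby r (ga i.1.1 i.1.2 s) (ga i.2.1 i.2.2 t)),
        (e i.1.1 i.1.2 -> i.2.1 != i.1.1 -> i.2.1 != i.1.2 -> 1/3 <= s <= 2/3 ->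
          0 <= t <= 1/3 ->
           ~~ closeby r (ga i.1.1 i.1.2 s) (ga i.2.1 i.2.2 t)) &
        (e i.1.1 i.1.2 -> e i.2.1 i.2.2 ->
          finset.setU (finset.set1 i.1.1) (finset.set1 i.1.2) != finset.setU
            (finset.set1 i.2.1) (finset.set1 i.2.2) -> 1/3 <= s <= 2/3 ->
              1/3 <= t <= 2/3 ->
           ~~ closeby r (ga i.1.1 i.1.2 s) (ga i.2.1 i.2.2 t))]).
- move=> [[x y] [z w]] r r' rr' H s t; case: (H s t) => /= h1 h2 h3.
  by split=> *; apply: closeby_anti rr' _; [apply: h1 | apply: h2 | apply: h3].
- move=> [[x y] [z w]] /=.
  have A : exists2 r : R, 0 < r & forall s t, x != z -> 0 <= s <= 1/3 -> 0 <= t <= 1/3 ->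
      ~~ closeby r (ga x y s) (ga z w t).
    have [->|xz] := eqVneq x z; first by exists 1.
    have [s t hs ht|r r0 H] := sep x y z w 0 (1/3) 0 (1/3) l0 l13 l0 l13; last first.
      by exists r => // s t _; apply: H.
    rewrite {2}/ga; case: ifP => [ezw|_]; last by apply: gap => //; lra.
    have [->|/eqP t0] := eqVneq t 0.
      by have [_ _ -> _ _] := garc _ _ ezw; apply: gap => //; lra.
    rewrite /ga; case: ifP => [exy|_]; last by apply/nesym/gvert => //; lra.
    have [->|/eqP s0] := eqVneq s 0.
      by have [_ _ -> _ _] := garc _ _ exy; apply/nesym/gvert => //; lra.
    (* If both curves draw the same edge, from opposite ends, injectivity gives [s = 1 - t], which
       is impossible with [s] and [t] at most 1/3. *)
    have [E|ne] := eqVneq (finset.setU (finset.set1 x) (finset.set1 y))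
                          (finset.setU (finset.set1 z) (finset.set1 w)); last first.
      by apply: gdisj => //; lra.
    have zx : z = y.
      have : z \in finset.setU (finset.set1 x) (finset.set1 y) by rewrite E !inE eqxx.
      by rewrite !inE eq_sym (negbTE xz) => /eqP.
    have wx : w = x.
      have : x \in finset.setU (finset.set1 z) (finset.set1 w) by rewrite -E !inE eqxx.
      by rewrite !inE (negbTE xz) => /eqP.
    subst z w; have [_ inj _ _ ->] := garc _ _ exy; move=> E'.
    have : s = 1 - t by apply: inj E'; rewrite inE /=; lra.
    lra.
  have B : exists2 r : R, 0 < r & forall s t, e x y -> z != x -> z != y ->
      1/3 <= s <= 2/3 -> 0 <= t <= 1/3 -> ~~ closeby r (ga x y s) (ga z w t).
    have [exy|] := boolP (e x y); last by exists 1.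
    have [->|zx] := eqVneq z x; first by exists 1.
    have [->|zy] := eqVneq z y; first by exists 1.
    have [s t hs ht|r r0 H] := sep x y z w (1/3) (2/3) 0 (1/3) l13' l23 l0 l13;
      last first.
      by exists r => // s t _ _ _; apply: H.
    rewrite /ga exy; case: ifP => [ezw|_]; last by apply: gvert => //; lra.
    have [->|/eqP t0] := eqVneq t 0.
      by have [_ _ -> _ _] := garc _ _ ezw; apply: gvert => //; lra.
    apply: gdisj => //; [|lra|lra].
    apply/eqP => E.
    have : z \in finset.setU (finset.set1 x) (finset.set1 y) by rewrite E !inE eqxx.
    by rewrite !inE (negbTE zx) (negbTE zy).
  have C : exists2 r : R, 0 < r & forall s t, e x y -> e z w -> 
     finset.setU (finset.set1 x) (finset.set1 y) != finset.setU (finset.set1 z)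
       (finset.set1 w) ->
      1/3 <= s <= 2/3 -> 1/3 <= t <= 2/3 -> ~~ closeby r (ga x y s) (ga z w t).
    have [exy|] := boolP (e x y); last by exists 1.
    have [ezw|] := boolP (e z w); last by exists 1.
    have [E|ne] := eqVneq (finset.setU (finset.set1 x) (finset.set1 y))
                          (finset.setU (finset.set1 z) (finset.set1 w)).
      by exists 1 => // s t; rewrite E eqxx.
    have [s t hs ht|r r0 H] := sep x y z w (1/3) (2/3) (1/3) (2/3) l13' l23 l13' l23;
      last first.
      by exists r => // s t _ _ _; apply: H.
    by rewrite /ga exy ezw; apply: gdisj => //; lra.
  case: A => r1 r10 A; case: B => r2 r20 B; case: C => r3 r30 C.
  exists (Num.min r1 (Num.min r2 r3)); first by rewrite !lt_min r10 r20 r30.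
  move=> s t; split=> *.
  + by apply: closeby_anti (A s t _ _ _) => //; rewrite ge_min lexx.
  + by apply: closeby_anti (B s t _ _ _ _ _) => //; rewrite !ge_min lexx orbT.
  + by apply: closeby_anti (C s t _ _ _ _ _) => //; rewrite !ge_min lexx !orbT.
move=> rho rho0 H; exists ga, rho; split=> //.
- by move=> x y z; rewrite !ga0.
- move=> x y eps e0.
  have [d1 d10 H1] := Arcs.unif_cont (c1 x y) e0.
  have [d2 d20 H2] := Arcs.unif_cont (c2 x y) e0.
  exists (Num.min d1 d2); first by rewrite lt_min d10.
  move=> s t hs ht; rewrite lt_min => /andP[h1 h2].
  by rewrite /closeby; apply/andP; split; apply: ltW; [apply: H1 | apply: H2].
(* The bound is written as an inverse radius, so that the common small radius yields a common upper
   bound. *)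
- have [] := @Arcs.fin_common_radius R (T * T)%type
    (fun i r => forall t, 0 < r -> 0 <= t <= 1 ->
      closeby r^-1 (ga i.1 i.2 t) (0, 0)).
  + move=> [x y] r r' rr' Hr t r'0 ht.
    have r0 : 0 < r by apply: lt_le_trans rr'.
    have ir : r^-1 <= r'^-1 by rewrite lef_pV2.
    have /andP[k1 k2] := Hr t r0 ht.
    by apply/andP; split; apply: le_trans ir.
  + move=> [x y] /=; have [M1 H1] := Arcs.arc_bounded (c1 x y).
    have [M2 H2] := Arcs.arc_bounded (c2 x y).
    exists (Num.max 1 (Num.max M1 M2))^-1.
      by rewrite invr_gt0 lt_max ltr01.
    move=> t _ ht; rewrite invrK /closeby /= !subr0 !le_max.
    by rewrite (H1 t ht) (H2 t ht) !orbT.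
  move=> r r0 Hr; exists r^-1 => x y t ht; exact: (Hr (x, y) t r0 ht).
- by move=> x y z w s t; case: (H (x, y, (z, w)) s t).
- by move=> x y z w s t; case: (H (x, y, (z, w)) s t).
- by move=> x y z w s t; case: (H (x, y, (z, w)) s t).
Qed.
End PlanarDrawing.

(** * Rounding curves to chains of grid points *)

Definition near1 (a b : nat) : bool := (a <= b.+1) && (b <= a.+1).
(** The 3 by 3 block of grid points centred at [k]. *)
Definition gnear N (c : 'I_N * 'I_N) (k : nat * nat) :
  bool := near1 c.1 k.1 && near1 c.2 k.2.

Section Link.
Variables (N : nat) (Bl : {set 'I_N.+1 * 'I_N.+1}).
Implicit Types (k : nat * nat).
Notation Pt := ('I_N.+1 * 'I_N.+1)%type.

Definition ctr k : Pt := (inord k.1, inord k.2).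

Lemma ctr_near k k' : k'.1 <= N -> k'.2 <= N -> near1 k'.1 k.1 -> near1 k'.2 k.2 ->
  gnear (ctr k') k.
Proof. by move=> h1 h2 n1 n2; rewrite /gnear /ctr /= !inordK ?n1. Qed.

(** Correct the first coordinate and then the second; the corner of this path stays in the block. *)
Lemma connect_block k (c : Pt) : k.1 <= N -> k.2 <= N ->
  (forall d, gnear d k -> d \in Bl) -> gnear c k ->
    connect (inside (@grid_adj N.+1) Bl) (ctr k) c.
Proof.
move=> k1 k2 H ck.
have nn a : near1 a a by rewrite /near1; lia.
case/andP: (ck) => c1 c2.
pose d : Pt := (c.1, inord k.2).
have dk : gnear d k by rewrite /gnear /d /= inordK // c1 nn.
have ek : gnear (ctr k) k by apply: ctr_near.
have one (a b : Pt) : gnear a k -> gnear b k -> (a == b) || grid_adj a b ->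
   connect (inside (@grid_adj N.+1) Bl) a b.
  move=> ak bk /orP[/eqP->|ab]; first exact: connect0.
  by apply: connect1; rewrite /inside /= ab !H.
apply: (@connect_trans _ _ d); apply: one => //.
  rewrite /ctr /d -pair_eqE /= eqxx andbT -val_eqE /grid_adj /= !inordK ?eqxx //=.
  by move: c1; rewrite /near1 /=; lia.
rewrite /d; case: c c2 {ck c1 d dk} => c1 c2 /= n2.
rewrite -pair_eqE /= eqxx -val_eqE /grid_adj /= !inordK ?eqxx //=.
by move: n2; rewrite /near1 /=; lia.
Qed.

Local Open Scope ring_scope.
(** Sample the curve at steps of [delta / 2]: each rounded point lies in the block of the preceding
    one, and blocks are connected. *)
Lemma connect_path (h : R -> nat * nat) (a b delta : R) :
  0 < delta -> a <= b ->
  (forall t, a <= t <= b -> ((h t).1 < N)%N && ((h t).2 < N)%N) ->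
  (forall t, a <= t <= b -> forall d, gnear d (h t) -> d \in Bl) ->
  (forall s t, a <= s <= b -> a <= t <= b -> `|s - t| < delta ->
     near1 (h s).1 (h t).1 && near1 (h s).2 (h t).2) ->
  connect (inside (@grid_adj N.+1) Bl) (ctr (h a)) (ctr (h b)).
Proof.
move=> d0 ab hN hBl hst.
suff H m t : a <= t <= b -> t - a < m%:R * (delta / 2) ->
    connect (inside (@grid_adj N.+1) Bl) (ctr (h a)) (ctr (h t)).
  apply: (H (Num.truncn ((b - a) / (delta / 2))).+1); first lra.
  rewrite -ltr_pdivrMr; last lra.
  by apply: truncnS_gt.
elim: m t => [|m IH] t tab; first by rewrite mul0r; lra.
rewrite -addn1 natrD mulrDl mul1r => tm.
(* The preceding sample, clipped to the start of the interval. *)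
pose s := Num.max a (t - delta / 2).
have sab : a <= s <= b by rewrite /s; case: (lerP a (t - delta / 2)) => ?; lra.
have st : `|t - s| < delta.
  by rewrite ltr_norml /s; case: (lerP a (t - delta / 2)) => ?; lra.
have /andP[n1 n2] := hst t s tab sab st.
have /andP[s1 s2] := hN s sab; have /andP[t1 t2] := hN t tab.
have [sm|sm] := boolP (s - a < m%:R * (delta / 2)).
  apply: connect_trans (IH s sab sm) _.
  apply: connect_block; [exact: ltnW | exact: ltnW | exact: hBl | ].
  by apply: ctr_near => //; exact: ltnW.
have : s = a.
  move: sm; rewrite -leNgt /s; case: (lerP a (t - delta / 2)) => ? ?; last by [].
  have : 0 <= m%:R * (delta / 2) by rewrite mulr_ge0 ?ler0n //; lra.
  lra.
move=> sa; rewrite -sa.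
apply: connect_block; [exact: ltnW | exact: ltnW | exact: hBl | ].
by apply: ctr_near => //; exact: ltnW.
Qed.
End Link.

Section Discretise.
Local Open Scope ring_scope.

Lemma near1_of_floor (m n : nat) (x y : R) :
  m%:R <= x < m%:R + 1 -> n%:R <= y < n%:R + 1 -> `|x - y| <= 1 -> near1 m n.
Proof.
move=> /andP[a1 a2] /andP[b1 b2]; rewrite ler_norml => /andP[c1 c2].
have h1 : m%:R < (n + 2)%:R :> R by rewrite natrD; lra.
have h2 : n%:R < (m + 2)%:R :> R by rewrite natrD; lra.
by move: h1 h2; rewrite !ltr_nat !addn2 /near1 !ltnS => -> ->.
Qed.

(** Indices near a common one differ by at most 2, and rounding down loses less than 1. *)
Lemma floor_of_near1 (c m n : nat) (x y : R) :
  m%:R <= x < m%:R + 1 -> n%:R <= y < n%:R + 1 -> near1 c m -> near1 c n -> `|x - y| <= 3.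
Proof.
move=> /andP[a1 a2] /andP[b1 b2] nx ny.
have [h1 h2] : (m <= n + 2)%N /\ (n <= m + 2)%N.
  by move: nx ny; rewrite /near1; clear; lia.
move: h1 h2; rewrite -!(ler_nat R) !natrD => h1 h2.
by rewrite ler_norml; lra.
Qed.

Lemma truncn_floor1 (x : R) : 0 <= x -> (Num.truncn x)%:R <= x < (Num.truncn x)%:R + 1.
Proof. by move=> x0; rewrite natr1 truncn_itv. Qed.

Lemma near1_inner (a k N : nat) :
  (1 < k)%N -> (k.+1 < N)%N -> near1 a k -> (0 < a)%N && (a.+1 < N.+1)%N.
Proof. by rewrite /near1; clear; lia. Qed.

Lemma truncn_near1 (x y : R) : 0 <= x -> 0 <= y -> `|x - y| <= 1 ->
  near1 (Num.truncn x) (Num.truncn y).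
Proof. by move=> x0 y0; apply: near1_of_floor; apply: truncn_floor1. Qed.

Lemma near1_truncn (c : nat) (x y : R) : 0 <= x -> 0 <= y ->
  near1 c (Num.truncn x) -> near1 c (Num.truncn y) -> `|x - y| <= 3.
Proof. by move=> x0 y0; apply: floor_of_near1; apply: truncn_floor1. Qed.

Variables (T : finType) (e : rel T) (ga : T -> T -> R -> R * R) (rho : R).
Hypothesis (esg : simple_graph e) (D : drawing e ga rho).

Lemma drawing_quantised : exists (N : nat) (q : T -> T -> R -> nat * nat),
  [/\ (forall x y z, q x y 0 = q x z 0) /\
    (forall x y t, e x y -> q y x t = q x y (1 - t)),
     (exists2 delta, 0 < delta & forall x y s t, 0 <= s <= 1 -> 0 <= t <= 1 ->
       `|s - t| < delta ->
        near1 (q x y s).1 (q x y t).1 && near1 (q x y s).2 (q x y t).2),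
     (forall x y t, 0 <= t <= 1 -> [&& (1 < (q x y t).1)%N, ((q x y t).1.+1 < N)%N,
         (1 < (q x y t).2)%N & ((q x y t).2.+1 < N)%N]) &
     (forall (c : 'I_N.+1 * 'I_N.+1) x y s z w t, 0 <= s <= 1 -> 0 <= t <= 1 ->
        gnear c (q x y s) -> gnear c (q z w t) -> closeby rho (ga x y s) (ga z w t))].
Proof.
have [M0 HM] := dr_bounded D; have r0 := dr_rho D.
(* With this scale [rho] becomes 3, the bound of [floor_of_near1]: curves farther apart than [rho]
   never share a block. *)
pose kap : R := 3 / rho.
have k0 : 0 < kap by rewrite divr_gt0.
(* The shift makes scaled coordinates at least 2, so that whole blocks avoid the border. *)
pose M := M0 + 2 / kap.
have Mk : M * kap = M0 * kap + 2 by rewrite /M mulrDl divfK // lt0r_neq0.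
pose N := (Num.truncn (M0 * kap * 2 + 2)).+3.
pose q x y t := (Num.truncn (((ga x y t).1 + M) * kap),
  Num.truncn (((ga x y t).2 + M) * kap)).
have rng (a : R) : `|a - 0| <= M0 -> 2 <= (a + M) * kap <= M0 * kap * 2 + 2.
  rewrite subr0 ler_norml mulrDl Mk => /andP[a1 a2].
  have : - M0 * kap <= a * kap by rewrite ler_pM2r.
  have : a * kap <= M0 * kap by rewrite ler_pM2r.
  by lra.
have qge x y t : 0 <= t <= 1 ->
  0 <= ((ga x y t).1 + M) * kap /\ 0 <= ((ga x y t).2 + M) * kap.
  by move=> ht; have /andP[/rng + /rng] := HM x y t ht; lra.
have scal (a b : R) : (a + M) * kap - (b + M) * kap = (a - b) * kap by ring.
exists N, q; split.
- split=> [x y z|x y t exy]; first by rewrite /q (dr_start D x y z).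
  by rewrite /q (dr_rev D).
- have [] := @Arcs.fin_common_radius _ (T * T)%type
    (fun i (d : R) => forall s t : R, 0 <= s <= 1 -> 0 <= t <= 1 -> `|s - t| < d ->
        near1 (q i.1 i.2 s).1 (q i.1 i.2 t).1 && near1 (q i.1 i.2 s).2 (q i.1 i.2 t).2).
  + move=> i r r' rr' H s t hs ht st; apply: H => //; exact: lt_le_trans rr'.
  + move=> [x y] /=.
    have ik : 0 < kap^-1 by rewrite invr_gt0.
    have [d d0 H] := dr_unif D x y ik.
    exists d => // s t hs ht st; have /andP[c1 c2] := H s t hs ht st.
    have [s1 s2] := qge x y s hs; have [t1 t2] := qge x y t ht.
    by apply/andP; split; apply: truncn_near1 => //;
      rewrite scal normrM (gtr0_norm k0) -ler_pdivlMr // div1r.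
  by move=> d d0 H; exists d => // x y; apply: (H (x, y)).
- move=> x y t ht; have [t1 t2] := qge x y t ht.
  have /andP[/rng/andP[a1 a2] /rng/andP[b1 b2]] := HM x y t ht.
  have u1 := le_truncn a2; have u2 := le_truncn b2.
  rewrite /q /N /= !ltnS !(leqW u1) !(leqW u2) !truncn_ge_nat //.
  by rewrite a1 b1.
- move=> c x y s z w t hs ht /andP[a1 a2] /andP[b1 b2].
  have [s1 s2] := qge x y s hs; have [t1 t2] := qge z w t ht.
  have := near1_truncn s1 t1 a1 b1; have := near1_truncn s2 t2 a2 b2.
  rewrite !scal !(normrM _ kap) !(gtr0_norm k0) /closeby.
  have e3 : 3 = rho * kap by rewrite /kap mulrC divfK // lt0r_neq0.
  by rewrite e3 !ler_pM2r // => -> ->.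
Qed.

(** The branch set of [x] is built from the blocks along the outer thirds at [x] and along the
    middle thirds assigned to [x]; the separations in [drawing] keep different branch sets
    disjoint. *)
Lemma drawing_grid_minor : exists N (B : T -> {set 'I_N.+1 * 'I_N.+1}), grid_minor e B.
Proof.
have [esym eirr] := esg.
have [N [q [[q0 qrev] [dl dl0 qstep] qin qsep]]] := drawing_quantised.
pose Pt := ('I_N.+1 * 'I_N.+1)%type.
pose core x : {set Pt} :=
  [set c | boolp.asbool (exists y t, 0 <= t <= 1/3 /\ gnear c (q x y t))].
pose mid x y : {set Pt} :=
  [set c | boolp.asbool (exists t, 1/3 <= t <= 2/3 /\ gnear c (q x y t))].
have coreP x c : reflect (exists y t, 0 <= t <= 1/3 /\ gnear c (q x y t)) (c \in core x).
  by rewrite inE; apply: boolp.asboolP.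
have midP x y c : reflect (exists t, 1/3 <= t <= 2/3 /\ gnear c (q x y t))
  (c \in mid x y).
  by rewrite inE; apply: boolp.asboolP.
pose fwd x y := e x y && (enum_rank x < enum_rank y)%N.
(* A middle third goes to its end of smaller rank, less the core of the other end, which it runs
   into. *)
pose zone x := core x :|: \bigcup_(y | fwd x y) (mid x y :\: core y).
pose root x : Pt := ctr N (q x x 0).
(* Taking away core points may disconnect a zone, so only the component of the vertex is
   retained. *)
pose blob x := [set c in zone x | connect (inside (@grid_adj N.+1) (zone x)) (root x) c].
have blobE x c : (c \in blob x) = (c \in zone x) && connect
  (inside (@grid_adj N.+1) (zone x)) (root x) c.
  by rewrite [LHS]inE.
have gs := @grid_adj_sym N.+1.
have core_core x z c : x != z -> c \in core x -> c \in core z -> False.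
  move=> xz /coreP[y [s [hs cs]]] /coreP[w [t [ht ct]]].
  by have := dr_stars D y w xz hs ht; rewrite (qsep c x y s z w t) //; lra.
have mid_core x y z c : e x y -> z != x -> z != y -> c \in mid x y -> c \in core z ->
  False.
  move=> exy zx zy /midP[s [hs cs]] /coreP[w [t [ht ct]]].
  by have := dr_mid_star D w exy zx zy hs ht; rewrite (qsep c x y s z w t) //; lra.
have mid_mid x y u v c : e x y -> e u v -> [set x; y] != [set u; v] -> c \in mid x y ->
  c \in mid u v -> False.
  move=> exy euv ne /midP[s [hs cs]] /midP[t [ht ct]].
  by have := dr_mids D exy euv ne hs ht; rewrite (qsep c x y s u v t) //; lra.
have zone_core x z c : x != z -> c \in zone x -> c \in core z -> False.
  move=> xz; rewrite inE => /orP[|/bigcupP[y /andP[exy _]]]; first exact: core_core.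
  rewrite inE => /andP[cy cm] cz.
  have zy : z != y by apply: contraNneq cy => <-.
  by apply: mid_core cm cz => //; rewrite eq_sym.
(* Zones could only meet in the middle third of one common edge, and [fwd] assigns it to a single
   end. *)
have zone_zone x z c : x != z -> c \in zone x -> c \in zone z -> False.
  move=> xz cx; rewrite inE => /orP[|/bigcupP[w /andP[ezw rzw]]];
    first exact: zone_core cx.
  rewrite inE => /andP[cw cm'].
  move: cx; rewrite inE => /orP[cx|/bigcupP[y /andP[exy rxy]]].
    have xw : x != w by apply: contraNneq cw => <-.
    exact: mid_core cm' cx.
  rewrite inE => /andP[cy cm].
  apply: mid_mid cm cm' => //; apply/eqP => E.
  have zy : z = y.
    have : z \in [set x; y] by rewrite E !inE eqxx.
    by rewrite !inE eq_sym (negbTE xz) => /eqP.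
  have wx : w = x.
    have : x \in [set z; w] by rewrite -E !inE eqxx.
    by rewrite !inE (negbTE xz) => /eqP.
  by subst; move: rxy; rewrite ltnNge (ltnW rzw).
have qlt x y t : 0 <= t <= 1 -> ((q x y t).1 < N)%N && ((q x y t).2 < N)%N.
  by move=> /(qin x y) /and4P[_ h1 _ h2]; rewrite (ltnW h1) (ltnW h2).
have nn a : near1 a a by rewrite /near1 leqnSn.
have ctr_self x y t : 0 <= t <= 1 -> gnear (ctr N (q x y t)) (q x y t).
  by move=> /(qlt x y) /andP[h1 h2]; apply: ctr_near => //; apply: ltnW.
have core_blob x c : c \in core x -> c \in blob x.
  move=> cx; rewrite blobE [c \in zone x]inE cx /=.
  case/coreP: (cx) => y [t [ht ct]].
  have cb s : 0 <= s <= t -> forall d, gnear d (q x y s) -> d \in zone x.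
    move=> hs d dn; rewrite inE; apply/orP; left; apply/coreP; exists y, s; split => //;
      lra.
  have /andP[l1 l2] : ((q x y t).1 < N)%N && ((q x y t).2 < N)%N by apply: qlt; lra.
  apply: (@connect_trans _ _ (ctr N (q x y t))).
    rewrite /root (q0 x x y); apply: (connect_path dl0) => //; first lra.
    - by move=> s hs; apply: qlt; lra.
    - by move=> s s' hs hs'; apply: qstep; lra.
  apply: connect_block ct; [exact: ltnW | exact: ltnW | apply: cb; lra].
have adjf x y : fwd x y -> exists2 ab,
  (ab.1 \in blob x) && (ab.2 \in blob y) & grid_adj ab.1 ab.2.
  move=> fxy; have /andP[exy rxy] := fxy.
  have xy : x != y by apply: contraTneq exy => ->; rewrite eirr.
  have a0 : ctr N (q x y (1/3)) \in blob x.
    by apply/core_blob/coreP; exists y, (1/3); split; [lra | apply: ctr_self; lra].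
  have b0 : ctr N (q x y (2/3)) \in core y.
    apply/coreP; exists x, (1/3); split; first lra.
    have -> : q x y (2/3) = q y x (1/3) by rewrite (qrev _ _ _ exy); congr (q x y _); lra.
    by apply: ctr_self; lra.
  have cm t : 1/3 <= t <= 2/3 -> forall d, gnear d (q x y t) -> d \in mid x y.
    by move=> ht d dn; apply/midP; exists t.
  have : connect (inside (@grid_adj N.+1) (mid x y)) (ctr N (q x y (1/3)))
    (ctr N (q x y (2/3))).
    apply: (connect_path dl0) => //; first lra.
    - by move=> s hs; apply: qlt; lra.
    - by move=> s s' hs hs'; apply: qstep; lra.
  (* Walk along the middle third towards [y]: before the first point of [core y] the chain stays in
     [blob x], and the step into [core y] is the required adjacency. *)
  case/connectP => p; move: (ctr N _) a0 => a; elim: p a => [|b p IH] a ax /=.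
    move=> _ ab; rewrite ab in b0; exfalso.
    by move: ax; rewrite blobE => /andP[az _]; apply: zone_core az b0.
  move=> /andP[/and3P[ab am bm] pp] lp.
  have [bcy|bcy] := boolP (b \in core y).
    by exists (a, b) => //=; rewrite ax core_blob.
  apply: IH pp lp.
  have bz : b \in zone x.
    by rewrite inE; apply/orP; right; apply/bigcupP; exists y => //; rewrite inE bcy.
  move: ax; rewrite !blobE bz => /andP[az ac] /=.
  apply: connect_trans ac (connect1 _).
  by rewrite /inside /= ab az.
exists N, blob; split.
- move=> x y xy; apply/pred0P => c /=; apply/negP => /andP[].
  by rewrite !blobE => /andP[cx _] /andP[cy _]; apply: zone_zone cx cy.
- move=> x a b; rewrite !blobE => /andP[_ ra] /andP[_ rb].
  apply: (@connect_trans _ _ (root x)); last exact: component_connected.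
  by rewrite inside_connect_sym //; apply: component_connected.
- move=> x y exy.
  have [xy|xy|xy] := ltngtP (enum_rank x) (enum_rank y).
  + by apply: adjf; rewrite /fwd exy.
  + have [|[a b] /andP[/= h1 h2] h3] := adjf y x; first by rewrite /fwd esym exy.
    by exists (b, a); rewrite /= ?h1 ?h2 // gs.
  + by move/val_inj/enum_rank_inj: xy exy => ->; rewrite eirr.
- move=> x a; rewrite blobE => /andP[+ _].
  have inner y z t : 0 <= t <= 1 -> gnear a (q y z t) ->
    [&& 0 < a.1, a.1.+1 < N.+1, 0 < a.2 & a.2.+1 < N.+1]%N.
    move=> /(qin y z) /and4P[h1 h2 h3 h4] /andP[n1 n2].
    have /andP[-> ->] := near1_inner h1 h2 n1.
    exact: near1_inner h3 h4 n2.
  rewrite inE => /orP[/coreP[y [t [ht ct]]]|/bigcupP[y _]].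
    by apply: inner ct; lra.
  by rewrite inE => /andP[_ /midP[t [ht ct]]]; apply: inner ct; lra.
Qed.
End Discretise.
Lemma planar_grid_minor (T : finType) (e : rel T) : simple_graph e -> planar e ->
  exists N (B : T -> {set 'I_N.+1 * 'I_N.+1}), grid_minor e B.
Proof.
move=> sg pl; have [ga [rho D]] := PlanarDrawing.planar_drawing sg pl.
exact: drawing_grid_minor D.
Qed.

End Discretisation.

(** * Orientations and choosability *)

Section Orientation.
Variables (T : finType) (m : nat).
Implicit Types (A : {set {set T}}) (o : {ffun {set T} -> T}).

(* [o] orients the edge [f] out of its end [o f]. *)
Definition orients A o := forall f, f \in A -> o f \in f.
(** The outdegree of [v]. *)
Definition load A o (v : T) := #|[set f in A | o f == v]|.
Definition arrow A o : rel T :=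
  fun u v => ([set u; v] \in A) && (o [set u; v] == u) && (u != v).

Lemma load_flip A o u v : arrow A o u v ->
  let o' := [ffun f => if f == [set u; v] then v else o f] in
  [/\ orients A o -> orients A o', load A o u = (load A o' u).+1,
    load A o' v = (load A o v).+1 &
      forall w, w != u -> w != v -> load A o' w = load A o w].
Proof.
move=> /andP[/andP[uvA /eqP ouv] uv] o'; pose g := [set u; v].
have o'g : o' g = v by rewrite ffunE eqxx.
have o'f f : f != g -> o' f = o f by move=> fg; rewrite ffunE (negbTE fg).
split.
- move=> oA f fA; have [->|fg] := eqVneq f g; first by rewrite o'g !inE eqxx orbT.
  by rewrite o'f // oA.
- rewrite /load (cardsD1 g) inE uvA ouv eqxx /= add1n; congr _.+1; apply: eq_card => f.
  rewrite !inE; have [->|fg] := eqVneq f g; last by rewrite o'f.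
  by rewrite o'g [v == u]eq_sym (negbTE uv) andbF.
- rewrite /load (cardsD1 g) inE uvA o'g eqxx /= add1n; congr _.+1; apply: eq_card => f.
  rewrite !inE; have [->|fg] := eqVneq f g; last by rewrite o'f.
  by rewrite ouv (negbTE uv) andbF.
- move=> w wu wv; apply: eq_card => f; rewrite !inE; have [->|fg] := eqVneq f g;
    last by rewrite o'f.
  by rewrite o'g ouv ![_ == w]eq_sym (negbTE wu) (negbTE wv).
Qed.

(* Reverse the path. *)
Lemma load_path A o u p : orients A o -> path (arrow A o) u p -> uniq (u :: p) ->
  u != last u p ->
  exists o', [/\ orients A o', load A o u = (load A o' u).+1,
    load A o' (last u p) = (load A o (last u p)).+1 &
    forall w, w != u -> w != last u p -> load A o' w = load A o w].
Proof.
elim: p o u => [|v p IH] o u oA /=; first by rewrite eqxx.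
move=> /andP[uv pp] /andP[unp up] ul.
have [h1 h2 h3 h4] := load_flip uv; set o1 := [ffun f => _] in h1 h2 h3 h4.
have {}h1 := h1 oA.
have [vl|vl] := eqVneq v (last v p).
  by exists o1; rewrite -vl; split => // w wu wv; apply: h4.
(* The rest of the simple path avoids [u], so flipping [uv] leaves its arrows unchanged. *)
have pp1 : path (arrow A o1) v p.
  apply: (sub_in_path (P := predC1 u) _ _ pp); last first.
    by apply/allP => x xp; rewrite /=; apply: contraNneq unp => <-.
  move=> x y; rewrite !inE => xu yu /andP[/andP[k1 k2] k3].
  rewrite /arrow k1 k3 /o1 ffunE andbT /=; case: ([set x; y] =P [set u; v]) => [E|_];
    last exact: k2.
  have : u \in [set x; y] by rewrite E !inE eqxx.
  by rewrite !inE ![u == _]eq_sym (negbTE xu) (negbTE yu).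
have [o2 [k1 k2 k3 k4]] := IH o1 v h1 pp1 up vl.
have uv' : u != v by move: unp; rewrite inE negb_or => /andP[].
exists o2; split => //.
- by rewrite h2 k4.
- rewrite k3 h4 //; first by rewrite eq_sym.
  by rewrite eq_sym.
move=> w wu wl; have [->|wv] := eqVneq w v; last by rewrite k4 // h4.
by apply: succn_inj; rewrite -h3 k2.
Qed.

(** No arrow leaves [R], so an edge oriented out of a vertex of [R] has both ends in [R]. *)
Lemma load_out A o : orients A o ->
  (forall f, f \in A -> exists x y, x != y /\ f = [set x; y]) ->
  forall R : {set T}, (forall v w, v \in R -> arrow A o v w -> w \in R) ->
  \sum_(v in R) load A o v <= #|[set f in A | f \subset R]|.
Proof.
move=> oA A2 R cl.
have -> : \sum_(v in R) load A o v = #|[set f in A | o f \in R]|.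
  rewrite -sum1_card (partition_big o [in R]) /=; last by move=> f;
    rewrite inE => /andP[].
  apply: eq_bigr => v vR; rewrite sum1_card; apply: eq_card => f; rewrite !inE.
  rewrite -[RHS]/((f \in [set f0 in A | o f0 \in R]) && (o f == v)) inE.
  by have [ofv|] := eqVneq (o f) v; rewrite ?andbF // !andbT ofv vR andbT.
apply/subset_leq_card/subsetP => f; rewrite !inE => /andP[fA ofR]; rewrite fA /=.
have [x [y [xy fE]]] := A2 f fA.
have H a b : a != b -> f = [set a; b] -> o f = a -> f \subset R.
  move=> ab fab ofa; rewrite ofa in ofR.
  have bR : b \in R by apply: (cl a) => //; rewrite /arrow -fab fA ofa eqxx.
  by rewrite fab; apply/subsetP => z; rewrite !inE => /orP[/eqP->|/eqP->].
have := oA f fA; rewrite {2}fE !inE => /orP[/eqP|/eqP]; first exact: (H x y xy fE).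
by apply: (H y x); rewrite 1?eq_sym // setUC.
Qed.

(** Induction on the number of edges: orient the new edge out of [x], and if this overloads [x],
    repair it by reversing a path to a vertex with spare capacity. *)
Theorem hakimi_orientation (t0 : T) (A : {set {set T}}) :
  (forall f, f \in A -> exists x y, x != y /\ f = [set x; y]) ->
  (forall R : {set T}, R != set0 -> #|[set f in A | f \subset R]| <= m * #|R|) ->
  exists2 o, orients A o & forall v, load A o v <= m.
Proof.
move En : #|A| => n; elim: n A En => [|n IH] A An A2 dens.
  have A0 : A = set0 by apply/eqP; rewrite -cards_eq0 An.
  exists [ffun=> t0] => [f|v]; first by rewrite A0 inE.
  by rewrite /load A0 (eq_card0 (A := _)) // => f; rewrite !inE.
have [g gA] : exists g, g \in A by apply/card_gt0P; rewrite An.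
have [x [y [xy gE]]] := A2 g gA.
have An' : #|A :\ g| = n by move: An; rewrite (cardsD1 g) gA add1n => -[].
have [f|R R0|o' o'A o'm] := IH _ An'.
- by rewrite inE => /andP[_]; apply: A2.
- apply: leq_trans (dens R R0); apply/subset_leq_card/subsetP => f.
  by rewrite !inE -andbA => /and3P[_ -> ->].
pose o : {ffun {set T} -> T} := [ffun f => if f == g then x else o' f].
have og : o g = x by rewrite ffunE eqxx.
have of' f : f != g -> o f = o' f by move=> fg; rewrite ffunE (negbTE fg).
have oA : orients A o.
  move=> f fA; have [->|fg] := eqVneq f g; first by rewrite og gE !inE eqxx.
  by rewrite of' // o'A // !inE fg.
have lx : load A o x = (load (A :\ g) o' x).+1.
  rewrite /load (cardsD1 g) inE gA og eqxx /= add1n; congr _.+1; apply: eq_card => f.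
  by rewrite !inE; have [->|fg] //= := eqVneq f g; rewrite of'.
have lo w : w != x -> load A o w = load (A :\ g) o' w.
  move=> wx; apply: eq_card => f; rewrite !inE; have [->|fg] := eqVneq f g;
    last by rewrite of'.
  by rewrite og eq_sym (negbTE wx) andbF.
have [lt|ge] := ltnP (load (A :\ g) o' x) m.
  exists o => // v; have [->|vx] := eqVneq v x; first by rewrite lx.
  by rewrite lo.
(* Here [x] has outdegree [m.+1]. If all vertices reachable from it had outdegree at least [m], the
   closed set [R] would span more than [m * #|R|] edges. *)
pose R := [set w | connect (arrow A o) x w].
have xR : x \in R by rewrite inE connect0.
have [/existsP[w /andP[]]|/existsPn no] :=
  boolP [exists w, (w \in R) && (load A o w < m)].
  rewrite inE => /connectP[p pp wl]; move: (pp) wl => /shortenP[p' pp' up' _] wl lw.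
  have xl : x != last x p' by rewrite -wl; apply: contraTneq lw => <-;
    rewrite -leqNgt lx leqW.
  have [o2 [k1 k2 k3 k4]] := load_path oA pp' up' xl.
  exists o2 => // v; have [->|vx] := eqVneq v x.
    by move: k2; rewrite lx => -[<-].
  have [->|vw] := eqVneq v (last x p'); first by rewrite k3 -wl.
  by rewrite k4 // lo.
have R0 : R != set0 by apply/set0Pn; exists x.
have H : m * #|R| < \sum_(v in R) load A o v.
  rewrite mulnC -sum_nat_const (bigD1 x) //= [X in _ < X](bigD1 x) //= -addSn.
  apply: leq_add; first by rewrite lx ltnS.
  by apply: leq_sum => v /andP[vR _]; move: (no v); rewrite vR /= -leqNgt.
have cl v w : v \in R -> arrow A o v w -> w \in R.
  by rewrite !inE => xv vw; apply: connect_trans xv (connect1 vw).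
by have := leq_trans H (leq_trans (load_out oA A2 cl) (dens R R0)); rewrite ltnn.
Qed.
End Orientation.

(** Positivity of [d] takes care of the default value 0 of the maximum. *)
Lemma mad_lt (T : finType) (e : rel T) (d : rat) : (0 < d)%R ->
  (forall (U : {set T}) (A : {set {set T}}), is_subgraph e (U, A) -> U != set0 ->
     ((2 * #|A|)%N%:R < d * #|U|%:R)%R) -> (mad e < d)%R.
Proof.
move=> d0 H; rewrite /mad; elim/big_ind: _ => //.
  by move=> x y hx hy; rewrite gt_max hx.
move=> [U A] /andP[sub U0]; rewrite ltr_pdivrMr; first exact: H.
by rewrite ltr0n card_gt0.
Qed.

Section Choosable.
Variables (T : finType) (e : rel T) (m : nat).
Hypothesis esg : simple_graph e.
Hypothesis sparse : forall R : {set T}, R != set0 ->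
  #|[set f in gedges e | f \subset R]| <= m * #|R|.

Lemma sparse_adaptably_choosable : adaptably_choosable e m.+1.
Proof.
move=> F L Ls.
(* Orientations take values in [T], so the empty graph is treated apart. *)
have [T0|[t0 _]] := set_0Vmem [set: T].
  have no (t : T) : False by have := in_setT t; rewrite T0 inE.
  by exists (fun _ => 0%R); split => [u|v]; [case: (no u) | case: (no v)].
have [es ei] := esg.
have [|o oA om] := @hakimi_orientation _ m t0 (gedges e) _ sparse.
  move=> f /gedges_ex [x [y [exy fE]]]; exists x, y; split => //.
  by apply: contraTneq exy => ->; rewrite ei.
have pickc v : exists c, c \in L v /\ forall f, f \in gedges e -> o f = v -> F f != c.
  pose bad := [seq F f | f <- enum [set f in gedges e | o f == v]].
  have [/hasP[c cL cb]|no] := boolP (has [predC bad] (undup (L v))).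
    rewrite mem_undup in cL; exists c; split => // f fA ofv; apply: contraNneq cb => <-.
    by apply: map_f; rewrite mem_enum inE fA ofv eqxx.
  (* Otherwise all of the at least [m.+1] colours of the list would occur on the at most [m]
     outgoing edges. *)
  have sub : {subset undup (L v) <= bad}.
    by move=> c cL; apply: contraNT no => cb; apply/hasP; exists c.
  have := leq_trans (Ls v) (uniq_leq_size (undup_uniq _) sub).
  by rewrite size_map -cardE ltnNge om.
have [c cP] := fin_all_exists pickc.
exists c; split => [u v euv [cu cv]|v]; last by have [] := cP v.
have uvA : [set u; v] \in gedges e by rewrite gedgesP.
have := oA _ uvA; rewrite !inE => /orP[/eqP ou|/eqP ov].
  by have [_ /(_ _ uvA ou)] := cP u; rewrite cu eqxx.
by have [_ /(_ _ uvA ov)] := cP v; rewrite cv eqxx.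
Qed.
End Choosable.

Lemma undup_single (X : eqType) (s : seq X) (x0 x : X) :
  size (undup s) <= 1 -> x \in s -> x = head x0 s.
Proof.
move=> s1 xs; have hs : head x0 s \in s by case: s xs {s1} => [|y s] //=;
  rewrite mem_head.
move: s1 xs hs; rewrite -(mem_undup s) -(mem_undup s (head _ _)).
by case: (undup s) => [|y [|]] //= _; rewrite !inE => /eqP -> /eqP.
Qed.

(* Colour each edge with the colour shared by the lists of its ends. *)
Lemma adaptably_kd_choosable (T : finType) (e : rel T) k : symmetric e ->
  adaptably_choosable e k -> kd_choosable e k 1.
Proof.
move=> es ad L [Ls L1].
pose shared (f : {set T}) : int := 
  if [pick uv : T * T | (f == [set uv.1; uv.2]) && e uv.1 uv.2] is Some uv
  then head 0%R [seq x <- L uv.1 | x \in L uv.2] else 0%R.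
have [c [cad cL]] := ad shared L Ls.
exists c; split => // u v euv cuv.
(* A colour common to [u] and [v] lies in both lists, hence is the single shared one, in whichever
   order the ends were picked. *)
have cs : c u = shared [set u; v].
  rewrite /shared; case: pickP => [[x y] /= /andP[/eqP E exy]|no]; last first.
    by have := no (u, v); rewrite eqxx euv.
  have cx : c u \in [seq z <- L x | z \in L y].
    rewrite mem_filter; case: (set2_inj E) => -[<- <-]; first by rewrite cL cuv cL.
    by rewrite [c u \in L u]cL cuv cL.
  exact: undup_single (L1 x y exy) cx.
by apply: (cad u v euv); rewrite -cuv -cs.
Qed.

Theorem theorem4 (T : finType) (e : rel T) :
  simple_graph e -> planar e ->
  (* no triangle is adjacent to a triangle or to a 4-cycle *)
  (forall C D : {set {set T}}, is_cycle e 3 C ->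
     (is_cycle e 3 D \/ is_cycle e 4 D) -> ~ adjacent_cycles C D) ->
  (* each 5-cycle is adjacent to at most three triangles *)
  (forall D : {set {set T}}, is_cycle e 5 D ->
     forall S : {set {set {set T}}},
       (forall C, C \in S -> is_cycle e 3 C /\ adjacent_cycles C D) ->
       #|S| <= 3) ->
  [/\ (mad e < 4%:R)%R, adaptably_choosable e 3 & kd_choosable e 3 1].
Proof.
move=> sg pl noadj five; have [es ei] := sg.
have [N [B gm]] := Discretisation.planar_grid_minor sg pl.
have sparse (U : {set T}) (A : {set {set T}}) : is_subgraph e (U, A) -> U != set0 ->
  #|A| + 2 <= 2 * #|U|.
  move=> /andP[/= Asub /forallP AU] U0.
  have [F [FP F2 span]] := grid_minor_faces sg gm Asub.
  have h1 := faces_le sg noadj five Asub FP F2.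
  have AU' f : f \in A -> f \subset U by move=> fA; have := AU f; rewrite fA.
  have h2 := face_count sg Asub AU' U0 span.
  (* Doubling the second inequality and inserting the first gives [2a + 2 <= 2f + 2u <= a + 2u]. *)
  have arith (a f u : nat) : 2 * f <= a -> a + 1 <= f + u -> a + 2 <= 2 * u by lia.
  exact: arith h1 h2.
have ac : adaptably_choosable e 3.
  apply: sparse_adaptably_choosable => // R R0.
  (* The density condition of Hakimi's theorem is the bound for the subgraph induced on [R]. *)
  have := sparse R [set f in gedges e | f \subset R]; rewrite /is_subgraph /=.
  have -> : [set f in gedges e | f \subset R] \subset gedges e by apply/subsetP => f;
    rewrite inE => /andP[].
  have -> : [forall f in [set f in gedges e | f \subset R], f \subset R].
    by apply/forall_inP => f; rewrite inE => /andP[].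
  by move=> /(_ isT R0); apply: leq_trans; apply: leq_addr.
split => //; last exact: adaptably_kd_choosable.
apply: mad_lt => // U A sub U0; rewrite -natrM ltr_nat.
have arith (a u : nat) : a + 2 <= 2 * u -> 2 * a < 4 * u by lia.
exact: arith (sparse U A sub U0).
Qed.
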